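(* Let $c\in\{0,N\}$ and let $[x_k]=\{x_k\}_{k=0}^{N}$ be a zero-mean nonsingular Gaussian (ZMNG) sequence of $\mathbb{R}^d$-valued random vectors. Then $[x_k]$ is $CM_c$ if and only if it can be represented as $$x_k=y_k+\Gamma_k x_c,\qquad k\in[0,N]\setminus\{c\},$$ where $[y_k]_{[0,N]\setminus\{c\}}=\{y_k : k\in[0,N]\setminus\{c\}\}$ is a ZMNG Markov sequence, $x_c$ is a ZMNG vector uncorrelated with $[y_k]_{[0,N]\setminus\{c\}}$, and $\Gamma_k$, $k\in[0,N]\setminus\{c\}$, are some $d\times d$ matrices.
   Context: Sequences are indexed by the discrete interval $[0,N]=\{0,1,\dots,N\}$ (or by a subinterval of it), and each $x_k$ takes values in $\mathbb{R}^d$. ''ZMNG'' means zero-mean nonsingular Gaussian: the variables of the sequence are jointly Gaussian with mean zero and the covariance matrix of the whole stacked vector is nonsingular. In the representation, the variables $y_k$ and $x_c$ are understood to be jointly Gaussian, so uncorrelated means independent. $F(\cdot|\cdot)$ denotes the conditional cumulative distribution function. A sequence indexed by a discrete interval $\{a,\dots,b\}$ is Markov iff $F(\xi_k\,|\,y_a,\dots,y_j)=F(\xi_k\,|\,y_j)$ for all $j<k$ in $\{a,\dots,b\}$ and every $\xi_k\in\mathbb{R}^d$ (conditional CDFs of $y_k$ evaluated at $\xi_k$). For $c\in\{0,N\}$, $[x_k]$ is $CM_c$ (conditionally Markov) iff conditioned on the state $x_c$ it is Markov over $[0,N]\setminus\{c\}$; equivalently, iff $F(\xi_k\,|\,x_0,\dots,x_j,x_c)=F(\xi_k\,|\,x_j,x_c)$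 for all $j,k\in[0,N]$ with $j<k$ and every $\xi_k\in\mathbb{R}^d$. The case $c=0$ is called $CM_F$ and the case $c=N$ is called $CM_L$. *)

(* Defs.v *)
From HB Require Import structures.
From mathcomp Require Import all_boot all_order all_algebra.
From mathcomp Require Import all_classical all_reals all_analysis.
From mathcomp Require Import measurable_realfun.

Set Implicit Arguments.
Unset Strict Implicit.
Unset Printing Implicit Defensive.

Import Order.TTheory GRing.Theory Num.Theory.
Import numFieldNormedType.Exports.

Local Open Scope classical_set_scope.
Local Open Scope ring_scope.

Section finite_measure_of_measure.
Context d (T : measurableType d) (R : realType).
Variables (mu : {measure set T -> \bar R}) (mufin : fin_num_fun mu).

Definition finite_measure_of (_ : fin_num_fun mu) : set T -> \bar R := mu.

HB.instance Definition _ := Measure.on (finite_measure_of mufin).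
HB.instance Definition _ :=
  Measure_isFinite.Build _ _ _ (finite_measure_of mufin) mufin.

End finite_measure_of_measure.

Section conditional_probability.
Context {disp : measure_display} {T : measurableType disp} {R : realType}.
Variable P : probability T R.

(* f is a version of the conditional probability of A given the sigma-algebra
   <<s G>> generated by G. *)
Definition is_cond_prob (G : set (set T)) (A : set T) (f : T -> R) : Prop :=
  [/\ measurable_fun setT (f : g_sigma_algebraType G -> R),
      P.-integrable setT (EFin \o f) &
      forall B, <<s G >> B -> (\int[P]_(w in B) (f w)%:E = P (A `&` B))%E].

(* The default value of xget is only reached outside the hypotheses of
   cond_probP below; the chosen version is determined P-almost everywhere. *)
Definition cond_prob (G : set (set T)) (A : set T) : T -> R :=
  xget (cst 0) [set f | is_cond_prob G A f].

Lemma cond_probP (G : set (set T)) (A : set T) :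
  G `<=` measurable -> measurable A -> is_cond_prob G A (cond_prob G A).
Proof.
move=> GM mA.
have GsM : <<s G >> `<=` measurable.
  by apply: smallest_sub => //; exact: sigma_algebra_measurable.
pose i : T -> g_sigma_algebraType G := id.
have mi : measurable_fun setT i by move=> _ B /GsM mB; rewrite setTI.
pose i' : {mfun T >-> g_sigma_algebraType G} :=
  HB.pack i (isMeasurableFun.Build _ _ _ _ i mi).
pose mu := distribution P i'.
have [nu nuE] : exists nu : {finite_measure set (g_sigma_algebraType G) -> \bar R},
    forall B, nu B = P (B `&` A).
  have [nu0 nu0E] : exists nu0 : {measure set (g_sigma_algebraType G) -> \bar R},
      forall B, nu0 B = P (B `&` A).
    by unshelve eexists (pushforward (mrestr P mA) i' :
      {measure set (g_sigma_algebraType G) -> \bar R}).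
  have nu0fin : fin_num_fun nu0.
    by move=> B /GsM mB; rewrite nu0E; apply: fin_num_measure; exact: measurableI.
  by exists (finite_measure_of nu0fin).
have numu : nu `<< mu.
  apply/null_content_dominatesP => B mB muB0; rewrite nuE.
  apply/eqP; rewrite eq_le measure_ge0 andbT.
  rewrite -muB0; apply: le_measure; rewrite ?inE.
  - by apply: measurableI => //; exact: GsM.
  - exact: GsM.
  - exact: subIsetl.
pose h := Radon_Nikodym_SigmaFinite.f nu mu.
have h0 x : (0 <= h x)%E := Radon_Nikodym_SigmaFinite.f_ge0 numu x.
have hfin x : h x \is a fin_num := Radon_Nikodym_SigmaFinite.f_fin_num numu x.
have hint : mu.-integrable setT h :=
  Radon_Nikodym_SigmaFinite.f_integrable numu.
have mh : measurable_fun setT h := measurable_int _ hint.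
have hE B : <<s G >> B -> (\int[P]_(w in B) h w = P (A `&` B))%E.
  move=> mB; rewrite setIC -nuE (Radon_Nikodym_SigmaFinite.f_integral numu)//.
  by rewrite (ge0_integral_pushforward mi P mB (measurable_funTS mh)).
have hK : EFin \o (fun w : T => fine (h w)) = h.
  by apply/funext => w; exact: fineK.
rewrite /cond_prob; apply: (@xgetPex _ _ [set f | is_cond_prob G A f]).
exists (fun w => fine (h w)); split => //.
- exact: measurableT_comp mh.
- rewrite hK; apply/integrableP; split; first exact: measurableT_comp mh mi.
  under eq_integral do rewrite gee0_abs//.
  rewrite hE; last exact: (@measurableT _ (g_sigma_algebraType G)).
  by rewrite setIT ltey_eq fin_num_measure.
- move=> B mB; rewrite -hE//.
  by apply: eq_integral => w _; exact: fineK.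
Qed.

End conditional_probability.

Section gaussian.
Context {disp : measure_display} {T : measurableType disp} {R : realType}.
Variable P : probability T R.

(* normal_prob m 0 is not a point mass (normal_pdf takes a junk value there),
   hence the explicit degenerate case. *)
Definition gaussian_law (m s : R) : set R -> \bar R :=
  if s == 0 then \d_m else normal_prob m s.

Definition is_gaussian (X : T -> R) : Prop :=
  exists m s : R, forall A, measurable A ->
    pushforward P X A = gaussian_law m s A.

Definition jointly_gaussian (J : finType) (z : J -> T -> R) : Prop :=
  forall a : J -> R, is_gaussian (fun w => \sum_j a j * z j w).

Definition cov_mx (J : finType) (z : J -> T -> R) : 'M[R]_#|J| :=
  \matrix_(i, j) fine (covariance P (z (enum_val i)) (z (enum_val j))).

End gaussian.

(* Sequences of random vectors in R^d indexed by 'I_n. A subset S of indices is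
   given by a boolean predicate; values outside S are irrelevant. *)
Section sequences.
Context {disp : measure_display} {T : measurableType disp} {R : realType}.
Context {P : probability T R} {n d : nat}.
Implicit Types (x : 'I_n -> {RV P >-> d.-tuple R}) (S : pred 'I_n).

Definition rvec (X : {RV P >-> d.-tuple R}) (w : T) : 'cV[R]_d :=
  \col_i tnth (X w) i.

Definition stack S x : {k : 'I_n | S k} * 'I_d -> T -> R :=
  fun p w => rvec (x (val p.1)) w p.2 0.

Arguments stack : clear implicits.

Definition ZMNG S x : Prop :=
  [/\ jointly_gaussian P (stack S x),
      forall p, ('E_P[stack S x p] = 0)%E &
      cov_mx P (stack S x) \in unitmx].

Definition uncorrelated (X Y : {RV P >-> d.-tuple R}) : Prop :=
  forall i j : 'I_d,
    covariance P (fun w => rvec X w i 0) (fun w => rvec Y w j 0) = 0%E.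

(* The preimages generating the sigma-algebra of {x_k : k in S}. *)
Definition generators S x : set (set T) :=
  \bigcup_(k in [set k | S k]) preimage_set_system setT (x k) measurable.

(* F(xi | x_i, i in S) for the variable x_k; the event is the product order
   x_k <= xi. *)
Definition cond_cdf S x (k : 'I_n) (xi : 'cV[R]_d) : T -> R :=
  cond_prob P (generators S x) [set w | forall i, rvec (x k) w i 0 <= xi i 0].

Definition is_markov S x : Prop :=
  forall j k : 'I_n, S j -> S k -> (j < k)%N -> forall xi : 'cV[R]_d,
    cond_cdf [pred i : 'I_n | S i && (i <= j)%N] x k xi
    = cond_cdf (pred1 j) x k xi %[ae P].

Definition CM (c : 'I_n) x : Prop :=
  forall j k : 'I_n, (j < k)%N -> forall xi : 'cV[R]_d,
    cond_cdf [pred i : 'I_n | (i <= j)%N || (i == c)] x k xi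
    = cond_cdf (pred2 j c) x k xi %[ae P].

End sequences.

Arguments stack {disp T R P n d} S x.

(* Main.v *)
(** Everything is reduced to orthogonality in L2.  For jointly Gaussian centred
    variables, the conditional CDF of [z_k] given [z_S] depends only on [z_S']
    ([S'] contained in [S]) iff the residual of the L2 projection of [z_k] on
    the span of [z_S'] is orthogonal to the span of [z_S].  The "if" part holds
    because the residual is then independent of [z_S]; conversely, [z_k] is
    independent of the part [v] of [z_S] orthogonal to [z_S'], whence
    [E (z_k v) = 0].  With [Gamma_k x_c] the projection of [x_k] on [x_c] and
    [y_k = x_k - Gamma_k x_c], the residual condition for [x] given
    [x_0, ..., x_j, x_c] and that for [y] given [y_0, ..., y_j] are the same.

    Uncorrelated jointly Gaussian variables are independent because
    [E (cos (u + a) cos (v + b))] factorizes, and a bounded weight [W] with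
    [E (W cos (a f + b)) = 0] for all [a], [b] satisfies [E (W 1_{f <= t}) = 0]:
    Gaussian bumps are averages of cosines, and half-line indicators are limits
    of integrals of Gaussian bumps. *)
Require Import Defs.
From HB Require Import structures.
From mathcomp Require Import all_boot all_order all_algebra.
From mathcomp Require Import all_classical all_reals all_analysis.
From mathcomp Require Import measurable_realfun ring lra.

Set Implicit Arguments.
Unset Strict Implicit.
Unset Printing Implicit Defensive.

Import Order.TTheory GRing.Theory Num.Theory.
Import numFieldNormedType.Exports.

Local Open Scope classical_set_scope.
Local Open Scope ring_scope.

(** * Integrals against the normal law *)

(** Cosines with an arbitrary phase replace complex exponentials: the phase supplies the sines, and
    a product of two such cosines is half the sum of two others, so everything stays real and stable
    under linear combinations. Conditional CDFs are determined only up to null sets, and the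
    representation of [x] holds only almost surely; inner products do not see null sets, which is
    one reason to pass through orthogonality. Nonsingularity is handled by dual vectors: a family in
    a Gaussian space has nonsingular covariance iff for each member some element of the space has
    inner product one with it and zero with the others. The dual vectors of [x] at indices other
    than [c] also serve for [y]. The position of [c] at an end of the interval enters when the
    conditioning index [j] equals [c]. *)

Section normal_density_integral.
Context {R : realType}.
Variables m s : R.
Local Notation mu := (@lebesgue_measure R).
Local Notation nu := (@normal_prob R m s).

Let numu : nu `<< mu := @normal_prob_dominates R m s.

(** The Radon-Nikodym derivative of [nu] and [normal_pdf] have the same integral over every
    measurable set, so they agree almost everywhere. *)
Lemma ge0_integral_normal_prob (f : R -> \bar R) :
  (forall x, (0 <= f x)%E) -> measurable_fun setT f ->
  (\int[nu]_x f x = \int[mu]_x (f x * (normal_pdf m s x)%:E))%E.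
Proof.
move=> f0 mf.
rewrite -(Radon_Nikodym_SigmaFinite.change_of_variables numu)//=.
apply: ae_eq_integral => //.
- apply: emeasurable_funM => //; apply: (measurable_int mu).
  exact: Radon_Nikodym_SigmaFinite.f_integrable.
- apply: emeasurable_funM => //; apply/measurable_EFinP.
  exact: measurable_normal_pdf.
- apply: ae_eqe_mul2l => /=; apply: integral_ae_eq => //=.
  + exact: Radon_Nikodym_SigmaFinite.f_integrable.
  + by apply/measurable_EFinP; exact: measurable_normal_pdf.
  + by move=> E _ mE; rewrite -Radon_Nikodym_SigmaFinite.f_integral.
Qed.

Lemma integrable_normal_prob (f : R -> R) : measurable_fun setT f ->
  nu.-integrable setT (EFin \o f) <->
  mu.-integrable setT (fun x => (f x * normal_pdf m s x)%:E).
Proof.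
move=> mf.
have e : (\int[nu]_x `|(f x)%:E| = \int[mu]_x `|(f x * normal_pdf m s x)%:E|)%E.
  rewrite ge0_integral_normal_prob//; last first.
    by by move=> *; apply: measurableT_comp => //; exact/measurable_EFinP.
  apply: eq_integral => x _.
  by rewrite /= normrM (ger0_norm (normal_pdf_ge0 _ _ _)) EFinM.
split=> /integrableP[_ ioo]; apply/integrableP; split.
- apply/measurable_EFinP; apply: measurable_funM => //.
  exact: measurable_normal_pdf.
- by rewrite -e.
- exact/measurable_EFinP.
- by rewrite /= e.
Qed.

Lemma Rintegral_normal_prob (f : R -> R) :
  nu.-integrable setT (EFin \o f) ->
  \int[nu]_x f x = \int[mu]_x (f x * normal_pdf m s x).
Proof.
move=> intf; have mf : measurable_fun setT f.
  by have /integrableP[/measurable_EFinP] := intf.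
congr fine; rewrite -(Radon_Nikodym_change_of_variables numu)//=.
apply: ae_eq_integral => //.
- apply: emeasurable_funM; first exact/measurable_EFinP.
  by apply: (measurable_int mu); exact: Radon_Nikodym_integrable.
- apply/measurable_EFinP; apply: measurable_funM => //.
  exact: measurable_normal_pdf.
- rewrite [X in ae_eq _ _ _ X](_ : _ = (fun x => (f x)%:E *
    (normal_pdf m s x)%:E)%E); last by apply/funext => x; rewrite EFinM.
  apply: ae_eqe_mul2l => /=.
  apply: integral_ae_eq => //=.
  + exact: Radon_Nikodym_integrable.
  + by apply/measurable_EFinP; exact: measurable_normal_pdf.
  + by move=> E _ mE; rewrite -Radon_Nikodym_integral.
Qed.

End normal_density_integral.

(** * Stein's identity, moments and characteristic function of the normal law *)

Section stein.
Context {R : realType}.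
Variables m s : R.
Hypothesis s0 : s != 0.
Local Notation mu := (@lebesgue_measure R).
Local Notation nu := (@normal_prob R m s).
Local Notation p := (@normal_pdf R m s).

(** Doubling the standard deviation absorbs a quadratic factor. The wider density has integral one,
    so this single domination makes every function of at most quadratic growth integrable. *)
Lemma normal_pdf_weight : exists2 C : R, 0 <= C &
  forall x, (1 + `|x - m|) ^+ 2 * p x <= C * normal_pdf m (2 * s) x.
Proof.
have s20 : 2 * s != 0 by rewrite mulf_neq0// pnatr_eq0.
exists ((2 + 16 * s ^+ 2) * normal_peak s / normal_peak (2 * s)).
  rewrite divr_ge0 ?normal_peak_ge0// mulr_ge0 ?normal_peak_ge0//.
  by rewrite addr_ge0// mulr_ge0 ?sqr_ge0.
move=> x; rewrite !normal_pdfE//.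
set k2 := normal_peak (2 * s).
have k20 : k2 != 0 by rewrite gt_eqF// normal_peak_gt0.
rewrite mulrCA -[leRHS]mulrA (mulKf k20) [leRHS]mulrAC [leRHS]mulrC.
rewrite ler_wpM2l ?normal_peak_ge0// /normal_fun.
(* With this [u] the exponents for the deviations [s] and [2 * s] are [-4u] and [-u]. The weight is
   at most [(2 + 16 s^2) e^u], and [e^(-4u) <= e^(-2u)] leaves the factor [e^(-u)]. *)
pose u := (x - m) ^+ 2 / (8 * s ^+ 2).
have u0 : 0 <= u by rewrite divr_ge0 ?sqr_ge0// mulr_ge0 ?sqr_ge0.
have -> : - (x - m) ^+ 2 / (s ^+ 2 *+ 2) = u - 5 * u by rewrite /u; field.
have -> : - (x - m) ^+ 2 / ((2 * s) ^+ 2 *+ 2) = - u by rewrite /u; field.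
have e1 : (x - m) ^+ 2 = 8 * s ^+ 2 * u by rewrite /u; field.
have h1 : (1 + `|x - m|) ^+ 2 <= 2 + 16 * s ^+ 2 * u.
  have := sqr_ge0 (1 - `|x - m|).
  have := real_normK (num_real (x - m)); rewrite e1 => e2.
  by rewrite sqrrB sqrrD !expr1n e2; lra.
have h2 : 1 <= expR u by rewrite -(expR0 R) ler_expR.
have h3 : u <= expR u by have := expR_ge1Dx u; lra.
have h4 : expR (u - 5 * u) <= expR (- u - u) by rewrite ler_expR; lra.
rewrite (le_trans (ler_wpM2l (sqr_ge0 _) h4))// expRB.
rewrite mulrCA mulrC ler_wpM2r ?expR_ge0//.
rewrite ler_pdivrMr ?expR_gt0// (le_trans h1)//.
have := ler_wpM2l (sqr_ge0 s) h3; lra.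
Qed.

Lemma normal_prob_integrable_le2 (f : R -> R) K : measurable_fun setT f ->
  (forall x, `|f x| <= K * (1 + `|x - m|) ^+ 2) ->
  nu.-integrable setT (EFin \o f).
Proof.
move=> mf fK; apply/integrable_normal_prob => //.
have [C C0 HC] := normal_pdf_weight.
have K0 : 0 <= K.
  have := fK m; rewrite subrr normr0 addr0 expr1n mulr1; exact: le_trans.
apply: (@le_integrable _ _ _ mu _ _ _
  (fun x => (K * C)%:E * (normal_pdf m (2 * s) x)%:E)%E) => //.
- apply/measurable_EFinP; apply: measurable_funM => //.
  exact: measurable_normal_pdf.
- move=> x _; rewrite -EFinM !abse_EFin lee_fin [leRHS]ger0_norm; last first.
    by rewrite !mulr_ge0 ?normal_pdf_ge0.
  rewrite normrM (ger0_norm (normal_pdf_ge0 _ _ _)).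
  rewrite (le_trans (ler_wpM2r (normal_pdf_ge0 _ _ _) (fK x)))// -[leLHS]mulrA
    -[leRHS]mulrA.
  by rewrite ler_wpM2l// HC.
- by apply: integrableZl => //; exact: integrable_normal_pdf.
Qed.

Lemma normal_prob_integrable_le1 (f : R -> R) K : measurable_fun setT f ->
  (forall x, `|f x| <= K * (1 + `|x - m|)) ->
  nu.-integrable setT (EFin \o f).
Proof.
move=> mf fK; apply: (normal_prob_integrable_le2 mf (K := K)) => x.
have K0 : 0 <= K.
  have := fK m; rewrite subrr normr0 addr0 mulr1; exact: le_trans.
rewrite (le_trans (fK x))// ler_wpM2l// expr2 ler_peMr// ?addr_ge0//.
by rewrite lerDl.
Qed.

Lemma is_derive_normal_pdf x :
  is_derive x (1 : R) p (- ((x - m) / s ^+ 2 * p x)).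
Proof.
have -> : p = (fun y => normal_peak s *: expR (- (y - m) ^+ 2 / (s ^+ 2 *+ 2))).
  by apply/funext => y; rewrite normal_pdfE.
have h : is_derive x (1 : R) (fun y : R => - (y - m) ^+ 2 / (s ^+ 2 *+ 2))
    (- ((x - m) / s ^+ 2)).
  by apply: is_derive_eq; rewrite /GRing.scale/=; field.
have d1 := is_derive1_comp (is_derive_expR _) h.
apply: (is_derive_eq (is_deriveZ (normal_peak s) d1)).
by rewrite /GRing.scale/=; ring.
Qed.

Variables (g g' : R -> R) (K : R).
Hypothesis dg : forall x, is_derive x (1 : R) g (g' x).
Hypothesis cg' : continuous g'.
Hypothesis gK : forall x, `|g x| <= K * (1 + `|x - m|).
Hypothesis g'K : forall x, `|g' x| <= K * (1 + `|x - m|).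

Let cg : continuous g.
Proof. by move=> x; apply/differentiable_continuous/derivable1_diffP. Qed.

Let ig' : nu.-integrable setT (EFin \o g').
Proof. exact: normal_prob_integrable_le1 (continuous_measurable_fun cg') g'K.
  Qed.

Let K0 : 0 <= K.
Proof.
by have := g'K m; rewrite subrr normr0 addr0 mulr1; exact: le_trans.
Qed.

Let mg : measurable_fun setT g.
Proof. exact: continuous_measurable_fun. Qed.

Lemma stein_integrable : nu.-integrable setT (EFin \o (fun x => (x - m) * g x)).
Proof.
apply: (normal_prob_integrable_le2 (K := K)).
  by apply: measurable_funM => //; exact: measurable_funB.
move=> x; rewrite normrM mulrC (le_trans (ler_wpM2r _ (gK x)))//.
rewrite -mulrA ler_wpM2l// expr2 ler_wpM2l ?addr_ge0//.
by rewrite lerDr.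
Qed.

Let F x := g x * p x.
Let h x := (g' x - s ^- 2 * ((x - m) * g x)) * p x.

Let dF x : is_derive x (1 : R) F (h x).
Proof.
have dp := is_derive_normal_pdf x.
have dgx := dg x.
apply: (is_derive_eq (is_deriveM dgx dp)).
by rewrite /h /GRing.scale/=; field.
Qed.

Let cF : continuous F.
Proof. by move=> x; apply: cvgM; [exact: cg|exact: continuous_normal_pdf]. Qed.

Let ch : continuous h.
Proof.
move=> x; apply: cvgM; last exact: continuous_normal_pdf.
apply: cvgB; first exact: cg'.
apply: cvgM; first exact: cvg_cst.
by apply: cvgM; [apply: cvgB; [exact: cvg_id|exact: cvg_cst]|exact: cg].
Qed.

Let ik : nu.-integrable setT (EFin \o (fun x => g' x - s ^- 2 * ((x - m) * g
  x))).
Proof.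
have := integrableB measurableT ig' (integrableZl measurableT (s ^- 2)
  stein_integrable).
by apply: eq_integrable.
Qed.

Let ih : mu.-integrable setT (EFin \o h).
Proof.
apply/integrable_normal_prob => //.
by have /integrableP[/measurable_EFinP] := ik.
Qed.

(** The quadratic weight leaves one factor to spare: [F x] times [1 + |x - m|] is bounded, so the
    boundary terms are of order [1/n]. *)
Let Fcvg : F n.+1%:R - F (- n.+1%:R) @[n --> \oo] --> 0.
Proof.
have [C C0 HC] := normal_pdf_weight.
pose B := K * (C * normal_peak (2 * s)).
have FB x : `|F x| * (1 + `|x - m|) <= B.
  rewrite normrM (ger0_norm (normal_pdf_ge0 _ _ _)) mulrAC.
  rewrite (le_trans (y := K * ((1 + `|x - m|) ^+ 2 * p x)))//.
    rewrite mulrA ler_wpM2r ?normal_pdf_ge0// expr2 mulrA.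
    by rewrite ler_wpM2r ?addr_ge0.
  rewrite ler_wpM2l// (le_trans (HC x))// ler_wpM2l// normal_pdf_ub//.
  by rewrite mulf_neq0.
apply/cvgrPdist_le => e e0; near=> n.
have nB : B *+ 2 / e + `|m| <= n.+1%:R.
  rewrite -natr1 (@le_trans _ _ n%:R) ?lerDl//.
  by near: n; exact: nbhs_infty_ger.
have key x : `|x| = n.+1%:R -> `|F x| <= e / 2.
  move=> xn.
  have : B *+ 2 / e <= 1 + `|x - m|.
    have := ler_distD m x 0; rewrite !subr0 xn; lra.
  rewrite ler_pdivrMr// => h1.
  have [B0|B0] := ltP 0 B; last first.
    have := FB x. have : 0 <= `|F x| * `|x - m| by rewrite mulr_ge0.
    by rewrite mulrDr mulr1; lra.
  have x0 : 0 < 1 + `|x - m| by rewrite ltr_pwDl.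
  rewrite -(ler_pM2r x0) (le_trans (FB x))//.
  by rewrite mulrAC ler_pdivlMr// mulr_natr mulrC.
rewrite sub0r normrN (le_trans (ler_normB _ _))// [leRHS](splitr e).
by rewrite lerD// key ?normrN// ger0_norm.
Unshelve. all: end_near. Qed.

(** As [h] is the derivative of [F], its integral over [[-(n+1), n+1]] is the boundary difference;
    dominated convergence with bound [|h|] passes to the whole line. *)
Let int_h0 : (\int[mu]_x (h x)%:E = 0)%E.
Proof.
pose f_ n := (EFin \o h) \_ `[(- n.+1%:R : R), n.+1%:R].
have [|||||_ _] := @dominated_convergence _ _ R mu setT measurableT f_
  (EFin \o h) (abse \o (EFin \o h)).
- move=> n; apply/(measurable_restrictT _ _).1 => //.
  by apply/measurable_funTS; have := measurable_int _ ih.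
- exact: measurable_int ih.
- apply: aeW => x _; apply: cvg_near_cst; near=> n.
  rewrite /f_ patchE mem_set//= in_itv/= -ler_norml -natr1.
  rewrite (@le_trans _ _ n%:R) ?lerDl//.
  by near: n; exact: nbhs_infty_ger.
- exact: integrable_abse.
- apply: aeW => x n _; rewrite /f_ patchE; case: ifPn => //= _.
  by rewrite lee_fin normr0.
move=> h1; apply: (cvg_unique _ h1) => //.
have -> : (fun n => \int[mu]_x f_ n x)%E = (fun n => (F n.+1%:R - F (-
  n.+1%:R))%:E).
  apply/funext => n; rewrite -integral_mkcond.
  rewrite (@continuous_FTC2 _ h F)//.
  - by rewrite (@lt_trans _ _ 0)// oppr_lt0.
  - exact: continuous_subspaceT.
  - split.
    + by move=> x _; exact: ex_derive.
    + exact/cvg_at_right_filter/cF.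
    + exact/cvg_at_left_filter/cF.
  - by move=> x _; rewrite derive1E; exact: derive_val.
by apply: cvg_EFin Fcvg; exact: nearW.
Unshelve. all: end_near. Qed.

(** Integration by parts: [g p] has derivative [(g' - (x - m) g / s^2) p] and vanishes at
    infinity. *)
Lemma normal_prob_stein :
  \int[nu]_x ((x - m) * g x) = s ^+ 2 * \int[nu]_x g' x.
Proof.
have : \int[nu]_x (g' x - s ^- 2 * ((x - m) * g x)) = 0.
  by rewrite Rintegral_normal_prob// /Rintegral int_h0.
rewrite RintegralB//; last first.
  by have := integrableZl measurableT (s ^- 2) stein_integrable;
    apply: eq_integrable.
rewrite RintegralZl//; last exact: stein_integrable.
move=> /eqP; rewrite subr_eq0 => /eqP ->.
by rewrite mulVKf// expf_neq0.
Qed.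

End stein.

Section normal_moments.
Context {R : realType}.
Variables m s : R.
Hypothesis s0 : s != 0.
Local Notation nu := (@normal_prob R m s).

Lemma normal_prob_integrable_id : nu.-integrable setT (EFin \o id).
Proof.
apply: (normal_prob_integrable_le1 s0 (K := 1 + `|m|)) => [|x] //=.
have := ler_normD (x - m) m; rewrite subrK.
have : 0 <= `|m| * `|x - m| by rewrite mulr_ge0.
by rewrite mulrDr mulr1 mulrDl mul1r; lra.
Qed.

Lemma normal_prob_integrable_sqr :
  nu.-integrable setT (EFin \o (fun x => x ^+ 2)).
Proof.
apply: (normal_prob_integrable_le2 s0 (K := (1 + `|m|) ^+ 2)) => [|x].
  exact: measurable_funX.
rewrite normrX -exprMn lerXn2r// ?nnegrE ?mulr_ge0 ?addr_ge0//.
have := ler_normD (x - m) m; rewrite subrK.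
have : 0 <= `|m| * `|x - m| by rewrite mulr_ge0.
by rewrite mulrDr mulr1 mulrDl mul1r; lra.
Qed.

Let int_center : \int[nu]_x (x - m) = \int[nu]_x x - m.
Proof.
have icm : nu.-integrable setT (EFin \o cst m).
  by apply: finite_measure_integrable_cst.
rewrite RintegralB//; last exact: normal_prob_integrable_id.
by rewrite Rintegral_cst//= probability_setT mulr1.
Qed.

(** Stein's identity for the constant function [1]. *)
Lemma normal_prob_mean : \int[nu]_x x = m.
Proof.
have := @normal_prob_stein R m s s0 (cst 1) (cst 0) 1.
under eq_Rintegral do rewrite mulr1.
rewrite int_center Rintegral_cst// mul0r mulr0 => H; apply/eqP.
rewrite -subr_eq0; apply/eqP/H => x.
- exact: cvg_cst.
- by rewrite mul1r normr1 lerDl.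
- by rewrite mul1r normr0 addr_ge0.
Qed.

(** Stein's identity for the function [x - m]. *)
Lemma normal_prob_variance : \int[nu]_x (x - m) ^+ 2 = s ^+ 2.
Proof.
have := @normal_prob_stein R m s s0 (fun x => x - m) (cst 1) 1.
rewrite Rintegral_cst//= probability_setT !mulr1; apply => x.
- by apply: is_derive_eq; rewrite subr0.
- exact: cvg_cst.
- by rewrite mul1r lerDr.
- by rewrite mul1r normr1 lerDl.
Qed.

End normal_moments.

Section normal_char.
Context {R : realType}.
Variables s al : R.
Hypothesis s0 : s != 0.
Local Notation nu := (@normal_prob R 0 s).

(** Varying the phase [al] covers the real and the imaginary part of the characteristic function. *)
Let phi t := \int[nu]_x cos (t * x + al).

Let dcos t x : is_derive t (1 : R) (fun t => cos (t * x + al)) (- (x * sin (t *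
  x + al))).
Proof.
have h : is_derive t (1 : R) (fun t : R => t * x + al) x.
  by apply: is_derive_eq; rewrite /GRing.scale/=; ring.
apply: (is_derive_eq (is_derive1_comp (is_derive_cos _) h)).
by ring.
Qed.

Let ccos (t b : R) : continuous (fun x : R => cos (t * x + b)).
Proof.
move=> x; apply: (cvg_comp _ cos); last exact: continuous_cos.
by apply: cvgD; [apply: cvgM; [exact: cvg_cst|exact: cvg_id]|exact: cvg_cst].
Qed.

Let dsin t x : is_derive x (1 : R) (fun x => sin (t * x + al)) (t * cos (t * x
  + al)).
Proof.
have h : is_derive x (1 : R) (fun x : R => t * x + al) t.
  by apply: is_derive_eq; rewrite /GRing.scale/=; ring.
apply: (is_derive_eq (is_derive1_comp (is_derive_sin _) h)).
by ring.
Qed.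

Let icos t : nu.-integrable setT (EFin \o (fun x => cos (t * x + al))).
Proof.
apply: (normal_prob_integrable_le1 s0 (K := 1)) => [|x].
  exact: continuous_measurable_fun.
by rewrite mul1r (le_trans (cos_max _))// lerDl.
Qed.

(* The differential equation of the characteristic function, from Stein's
   identity. *)
Let dphi t : is_derive t (1 : R) phi (- (s ^+ 2 * t * phi t)).
Proof.
have It : `]t - 1, t + 1[%classic t by rewrite /= in_itv/=; apply/andP; split;
  lra.
have d1E u x : partial1of2 (fun t x => cos (t * x + al)) u x =
    - (x * sin (u * x + al)).
  by rewrite partial1of2E; exact: derive_val.
have intG : nu.-integrable setT (EFin \o (@Num.norm _ R)).
  exact/integrable_norm/normal_prob_integrable_id.
have h1 (u x : R) : `]t - 1, t + 1[%classic u -> setT x -> derivable (fun t : R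
  => cos (t * x + al)) u 1.
  by move=> _ _; exact: ex_derive.
have h2 (u x : R) : `]t - 1, t + 1[%classic u -> setT x ->
    `|partial1of2 (fun t x => cos (t * x + al)) u x| <= `|x|.
  by move=> _ _; rewrite d1E normrN normrM ler_piMr// sin_max.
apply: DeriveDef.
  exact: (derivable_under_integral measurableT It (fun u _ => icos u) h1
    (fun x => normr_ge0 x) intG h2).
rewrite -derive1E (differentiation_under_integral measurableT It
  (fun u _ => icos u) h1 (fun x => normr_ge0 x) intG h2).
have st := @normal_prob_stein R 0 s s0 (fun x => sin (t * x + al))
  (fun x => t * cos (t * x + al)) (1 + `|t|) (dsin t).
have /st {}st : continuous (fun x => t * cos (t * x + al)).
  by move=> x; apply: cvgM; [exact: cvg_cst|exact: ccos].
transitivity (\int[nu]_x (- 1 * ((x - 0) * sin (t * x + al)))).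
  by apply: eq_Rintegral => x _; rewrite d1E subr0 mulN1r.
have sK x : `|sin (t * x + al)| <= (1 + `|t|) * (1 + `|x - 0|).
  rewrite (le_trans (sin_max _))//.
  by rewrite mulrDr mulr1 -addrA lerDl !addr_ge0// mulr_ge0// addr_ge0.
have cK x : `|t * cos (t * x + al)| <= (1 + `|t|) * (1 + `|x - 0|).
  rewrite normrM (@le_trans _ _ (`|t| * 1))//.
    by rewrite ler_wpM2l// cos_max.
  by rewrite mulr1 mulrDl mul1r mulrDr mulr1 addrC -addrA lerDl !addr_ge0//
    mulr_ge0.
rewrite RintegralZl//; last exact: (stein_integrable s0 (dsin t) sK cK).
by rewrite st// RintegralZl//; rewrite /phi; ring.
Qed.

(** The integrating factor [E] of the differential equation for [phi] makes [phi * E] constant; its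
    value is read off at [0]. *)
Lemma normal_prob_cos t :
  \int[nu]_x cos (t * x + al) = expR (- (t ^+ 2 * s ^+ 2 / 2)) * cos al.
Proof.
pose E u := expR (u ^+ 2 * s ^+ 2 / 2) : R.
have dE u : is_derive u (1 : R) E (s ^+ 2 * u * E u).
  have h : is_derive u (1 : R) (fun u : R => u ^+ 2 * s ^+ 2 / 2) (s ^+ 2 * u).
    by apply: is_derive_eq; rewrite /GRing.scale/=; field.
  apply: (is_derive_eq (is_derive1_comp (is_derive_expR _) h)).
  by rewrite mulrC.
have d0 u : is_derive u (1 : R) (phi * E) 0.
  have d1 := dphi u; have d2 := dE u.
  apply: (is_derive_eq (is_deriveM d1 d2)).
  by rewrite /GRing.scale/=; ring.
have := is_derive_0_is_cst t 0 d0; rewrite /= !fctE.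
have -> : E 0 = 1 by rewrite /E expr0n/= !mul0r expR0.
have -> : phi 0 = cos al.
  rewrite /phi; under eq_Rintegral do rewrite mul0r add0r.
  by rewrite Rintegral_cst//= probability_setT mulr1.
by rewrite mulr1 expRN => <-; rewrite mulrC mulfK// gt_eqF// expR_gt0.
Qed.

End normal_char.

(** * Expectations of functions of a Gaussian variable *)

Lemma integral_eq_law d1 d2 (T : measurableType d1) (U : measurableType d2)
    (R : realType) (mu : {measure set T -> \bar R})
    (nu : {measure set U -> \bar R}) (X : T -> U) (f : U -> R) :
  measurable_fun setT X ->
  (forall A, measurable A -> pushforward mu X A = nu A) ->
  measurable_fun setT f -> nu.-integrable setT (EFin \o f) ->
  mu.-integrable setT (EFin \o (f \o X)) /\
  \int[mu]_w f (X w) = \int[nu]_x f x.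
Proof.
move=> mX Xnu mf intf.
pose X' : {mfun T >-> U} := HB.pack X (isMeasurableFun.Build _ _ _ _ _ mX).
have intfX : mu.-integrable setT (EFin \o (f \o X)).
  apply/integrableP; split; first exact/measurable_EFinP/measurableT_comp.
  have /integrableP[_] := intf; apply: le_lt_trans.
  rewrite (eq_measure_integral (pushforward mu X'))//; last first.
    by move=> A mA _; rewrite -Xnu.
  rewrite (ge0_integral_pushforward mX)//.
  by apply: measurableT_comp => //; exact/measurable_EFinP.
split=> //; congr fine.
rewrite (eq_measure_integral (pushforward mu X')); last first.
  by move=> A mA _; rewrite -Xnu.
by rewrite (integral_pushforward mX)//; exact/measurable_EFinP.
Qed.

Section centered_gaussian.
Context {disp : measure_display} {T : measurableType disp} {R : realType}.
Variable P : probability T R.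
Implicit Type X : T -> R.

(** Separates point masses, for which an expectation is an evaluation at [m], from laws with a
    density, to which the preceding integrals apply. *)
Let gaussian_cases X : measurable_fun setT X -> is_gaussian P X ->
  (exists m s, s != 0 /\ forall f : R -> R, measurable_fun setT f ->
    (normal_prob m s).-integrable setT (EFin \o f) ->
    P.-integrable setT (EFin \o (f \o X)) /\
    \int[P]_w f (X w) = \int[normal_prob m s]_x f x) \/
  (exists m, forall f : R -> R, measurable_fun setT f ->
    P.-integrable setT (EFin \o (f \o X)) /\ \int[P]_w f (X w) = f m).
Proof.
move=> mX [m [s]]; rewrite /gaussian_law; case: ifPn => [_ Xm|s0 Xms].
  right; exists m => f mf.
  have intf : (\d_m : {measure set R -> \bar R}).-integrable setT (EFin \o f).
    apply/integrableP; split; first exact/measurable_EFinP.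
    rewrite integral_dirac//=; last exact/measurableT_comp/measurableT_comp.
    by rewrite diracT mul1e ltry.
  have [? ->] := integral_eq_law mX Xm mf intf; split=> //.
  rewrite /Rintegral integral_dirac//=; last exact/measurableT_comp.
  by rewrite indicT mul1r.
left; exists m, s; split=> // f mf intf.
exact: (@integral_eq_law _ _ T _ R P (normal_prob m s) X f mX Xms mf intf).
Qed.

Lemma gaussian_integrable X : measurable_fun setT X -> is_gaussian P X ->
  P.-integrable setT (EFin \o X).
Proof.
move=> mX /(gaussian_cases mX)[[m [s [s0 H]]]|[m H]].
  by have [] := H id (@measurable_id _ _ setT) (normal_prob_integrable_id m s0).
by have [] := H id (@measurable_id _ _ setT).
Qed.

Lemma gaussian_integrable_sqr X : measurable_fun setT X -> is_gaussian P X ->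
  P.-integrable setT (EFin \o (fun w => X w ^+ 2)).
Proof.
have msqr : measurable_fun setT (fun x : R => x ^+ 2) by exact: measurable_funX.
move=> mX /(gaussian_cases mX)[[m [s [s0 H]]]|[m H]].
  by have [] := H _ msqr (normal_prob_integrable_sqr _ s0).
by have [] := H _ msqr.
Qed.

(** Only the second moment appears on the right, which is why inner products alone will decide
    independence. A centred point mass sits at [0], where both sides are [cos al]. *)
Lemma gaussian_char X al : measurable_fun setT X -> is_gaussian P X ->
  \int[P]_w X w = 0 ->
  \int[P]_w cos (X w + al) = expR (- (\int[P]_w X w ^+ 2 / 2)) * cos al.
Proof.
have msqr : measurable_fun setT (fun x : R => x ^+ 2) by exact: measurable_funX.
have ccos : continuous (fun x : R => cos (x + al)).
  move=> x; apply: (cvg_comp _ cos); last exact: continuous_cos.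
  by apply: cvgD; [exact: cvg_id|exact: cvg_cst].
have mcos : measurable_fun setT (fun x : R => cos (x + al)).
  exact: continuous_measurable_fun.
move=> mX /(gaussian_cases mX)[[m [s [s0 H]]]|[m H]].
  have [_ ->] := H id (@measurable_id _ _ setT) (normal_prob_integrable_id m
    s0).
  rewrite /= normal_prob_mean// => m0; subst m.
  have [_ ->] := H _ msqr (normal_prob_integrable_sqr _ s0).
  have icos : (normal_prob 0 s).-integrable setT (EFin \o (fun x => cos (x +
    al))).
    apply: (normal_prob_integrable_le1 s0 (K := 1)) => // x.
    by rewrite mul1r (le_trans (cos_max _))// lerDl.
  have [_ ->] := H _ mcos icos.
  have := normal_prob_cos al s0 1.
  under eq_Rintegral do rewrite mul1r.
  move=> ->; rewrite expr1n mul1r -[s ^+ 2](normal_prob_variance 0 s0).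
  by under eq_Rintegral do rewrite subr0.
have [_ ->] := H id (@measurable_id _ _ setT); rewrite /= => m0.
have [_ ->] := H _ msqr; have [_ ->] := H _ mcos.
by rewrite m0 expr0n/= mul0r oppr0 expR0 mul1r add0r.
Qed.

End centered_gaussian.

Lemma normal_prob_chebyshev (R : realType) (m s e : R) (A : set R) :
  s != 0 -> 0 < e -> measurable A -> (forall y, A y -> e <= `|y - m|) ->
  (normal_prob m s A <= (s ^+ 2 / e ^+ 2)%:E)%E.
Proof.
move=> s0 e0 mA Ae.
have e20 : 0 < e ^+ 2 by rewrite exprn_gt0.
have icsqr : (normal_prob m s).-integrable setT (EFin \o (fun x => (x - m) ^+
  2)).
  apply: (normal_prob_integrable_le2 s0 (K := 1)) => [|x].
    by apply: measurable_funX; exact: measurable_funB.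
  by rewrite mul1r normrX lerXn2r// ?nnegrE ?addr_ge0// lerDr.
rewrite -(normal_prob_variance m s0) -[normal_prob m s A]fineK
  ?fin_num_measure//.
rewrite lee_fin ler_pdivlMr// mulrC.
have iA : (normal_prob m s).-integrable setT (EFin \o (\1_A : R -> R)).
  exact: integrable_indic.
have -> : fine (normal_prob m s A) = \int[normal_prob m s]_x \1_A x.
  by rewrite /Rintegral integral_indic// setIT.
rewrite -RintegralZl//; apply: le_Rintegral => //.
  by have := integrableZl measurableT (e ^+ 2) iA; apply: eq_integrable.
move=> x _; rewrite indicE; case: (boolP (x \in A)) => [|_]; last first.
  by rewrite mulr0 sqr_ge0.
rewrite inE mulr1 => /Ae h.
by rewrite -(real_normK (num_real (x - m))) lerXn2r ?nnegrE// ltW.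
Qed.

(* The shift [harmonic n] dominates the standard deviation [harmonic n ^+ 2], so
   that the limit is [1] also at [m = t]. *)
Lemma cvg_normal_prob_halfline (R : realType) (m t : R) :
  fine (normal_prob m (harmonic n ^+ 2) `]-oo, (t + harmonic n)]) @[n --> \oo]
    --> ((m <= t)%R%:R : R).
Proof.
have h0 n : 0 < harmonic n :> R by rewrite invr_gt0.
have s0 n : harmonic n ^+ 2 != 0 :> R by rewrite expf_neq0// gt_eqF.
have hle n : harmonic n ^+ 2 <= harmonic n :> R.
  by rewrite expr2 ler_piMr ?invr_le1 ?ler1n// ?unitfE ?pnatr_eq0// ltW.
have mI (u : R) : measurable `]-oo, u]%classic by [].
have pos n u : 0 <= fine (normal_prob m (harmonic n ^+ 2) `]-oo, u]).
  by rewrite fine_ge0.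
case: (leP m t) => [mt|tm].
  have key n : 1 - harmonic n <=
      fine (normal_prob m (harmonic n ^+ 2) `]-oo, (t + harmonic n)]) <= 1.
    pose A := `]-oo, (t + harmonic n)]%classic.
    have mA : measurable A by exact: mI.
    set p := normal_prob _ _ _;
      pose q := normal_prob m (harmonic n ^+ 2) (~` A).
    have pf : p \is a fin_num by exact: fin_num_measure.
    have qf : q \is a fin_num by apply: fin_num_measure; exact: measurableC.
    have qp : fine q = 1 - fine p.
      by rewrite /q (probability_setC (normal_prob m (harmonic n ^+ 2)) mA)
        fineB.
    have q0 : 0 <= fine p by exact: pos.
    (* Points beyond [t + harmonic n] are at distance at least [harmonic n] from [m], as [m <= t];
       Chebyshev's bound is then [harmonic n ^+ 2]. *)
    have : (q <= ((harmonic n ^+ 2) ^+ 2 / harmonic n ^+ 2)%:E)%E.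
      apply: (normal_prob_chebyshev (s0 n) (h0 n)); first exact: measurableC.
      move=> y; rewrite /A /= in_itv/= => /negP; rewrite -ltNge => yt.
      by rewrite ler_normr; apply/orP; left;
        rewrite lerBrDl (le_trans _ (ltW yt))// lerD2r.
    rewrite -(fineK qf) lee_fin expr2 mulfK//.
    have := hle n; have : 0 <= fine q by rewrite fine_ge0 ?measure_ge0.
    by move=> ? ? ?; apply/andP; split; lra.
  apply: (@squeeze_cvgr _ _ _ _ (fun n => 1 - harmonic n) (cst 1)).
  - exact: nearW.
  - rewrite -[X in _ --> X]subr0; apply: cvgB; first exact: cvg_cst.
    exact: cvg_harmonic.
  - exact: cvg_cst.
(* For [t < m] the half-line eventually ends below the midpoint of [t] and [m], hence stays at
   distance [(m - t) / 2] from [m]; [C] is the Chebyshev factor for that distance. *)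
pose C := ((m - t) / 2) ^- 2.
have d0 : 0 < (m - t) / 2 by lra.
apply: (@squeeze_cvgr _ _ _ _ (cst 0) (fun n => C * harmonic n)).
- near=> n; rewrite pos/=.
  have hn : harmonic n <= (m - t) / 2.
    have : `|harmonic n - 0 : R| <= (m - t) / 2.
      near: n; have /cvgrPdistC_le := @cvg_harmonic R.
      by apply.
    by rewrite subr0; apply: le_trans; exact: ler_norm.
  have := @normal_prob_chebyshev R m (harmonic n ^+ 2) ((m - t) / 2) _ (s0 n)
    d0 (mI (t + harmonic n)).
  set p := normal_prob _ _ _.
  have pf : p \is a fin_num by exact: fin_num_measure.
  rewrite -(fineK pf) lee_fin => H; apply: (le_trans (H _)).
    move=> y /=; rewrite in_itv/= => yt.
    rewrite ler_normr; apply/orP; right;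
      have := le_trans yt (lerD (lexx t) hn); lra.
  rewrite mulrC ler_wpM2l//; first by rewrite invr_ge0 sqr_ge0.
  rewrite (le_trans _ (hle n))// expr2 ler_piMr ?sqr_ge0//.
  by rewrite (le_trans (hle n))// invr_le1 ?ler1n// unitfE pnatr_eq0.
- exact: cvg_cst.
- rewrite -[X in _ --> X](mulr0 C); apply: cvgM; first exact: cvg_cst.
  exact: cvg_harmonic.
Unshelve. all: end_near. Qed.

(** * Functions orthogonal to all cosines *)

Lemma integrable_prod_bounded d1 d2 (T1 : measurableType d1)
    (T2 : measurableType d2) (R : realType) (P : probability T1 R)
    (Q : probability T2 R) (g : T1 * T2 -> R) (M : R) :
  measurable_fun setT g -> (forall z, `|g z| <= M) ->
  (P \x Q)%E.-integrable setT (EFin \o g).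
Proof.
move=> mg gM; apply/integrable12ltyP; first exact/measurable_EFinP.
apply: (@le_lt_trans _ _ (\int[P]_x \int[Q]_y (cst M%:E) (x, y))%E); last first.
  under eq_integral do rewrite integral_cst//= probability_setT mule1.
  by rewrite integral_cst//= probability_setT mule1 ltry.
have mag : measurable_fun setT (fun z => `|(EFin \o g) z|%E).
  by apply: measurableT_comp => //; exact/measurable_EFinP.
apply: ge0_le_integral => //.
- by move=> x _; exact: integral_ge0.
- exact: (@measurable_fun_fubini_tonelli_F _ _ T1 T2 R Q _ mag (fun=> abse_ge0
    _)).
- under [X in measurable_fun _ X]eq_fun do rewrite integral_cst//=.
  exact: measurable_cst.
- move=> x _; apply: ge0_le_integral => //.
  + exact: (measurableT_comp mag (pair1_measurable x)).
  + by move=> y _; rewrite /= lee_fin gM.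
Qed.

Lemma measurable_fun_le_indic d (T : measurableType d) (R : realType)
    (f : T -> R) (t : R) : measurable_fun setT f ->
  measurable_fun setT (fun w => (f w <= t)%R%:R : R).
Proof.
move=> mf; rewrite (_ : (fun w => _) = (\1_(`]-oo, t]%classic) : R -> R) \o f).
  by apply: measurableT_comp.
apply/funext => z /=; rewrite indicE; congr (_%:R); congr nat_of_bool.
by apply/idP/idP; rewrite inE/= in_itv.
Qed.

Section halfline.
Context {disp : measure_display} {T : measurableType disp} {R : realType}.
Variable P : probability T R.
Variables (W f : T -> R) (M : R).
Hypothesis mW : measurable_fun setT W.
Hypothesis WM : forall w, `|W w| <= M.
Hypothesis mf : measurable_fun setT f.
Hypothesis Wcos : forall a al, \int[P]_w (W w * cos (a * f w + al)) = 0.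
Local Notation mu := (@lebesgue_measure R).

Let M0 : 0 <= M.
Proof. by apply: le_trans (WM point). Qed.

Let mcosM (a al : R) : measurable_fun setT (fun w => cos (a * f w + al)).
Proof.
apply: measurableT_comp; first exact: continuous_measurable_fun
  (@continuous_cos R).
by apply: measurable_funD => //; apply: measurable_funM.
Qed.

Let iW (g : T -> R) : measurable_fun setT g -> (forall w, `|g w| <= 1) ->
  P.-integrable setT (EFin \o (fun w => W w * g w)).
Proof.
move=> mg g1.
apply: (@le_integrable _ _ _ P _ _ _ (EFin \o cst M)) => //.
- by apply/measurable_EFinP; exact: measurable_funM.
- move=> w _; rewrite lee_fin normrM [leRHS]ger0_norm//.
  by rewrite (le_trans (ler_wpM2r _ (WM w)))// ler_piMr.
- exact: finite_measure_integrable_cst.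
Qed.

Let iWn (s y : R) :
  P.-integrable setT (EFin \o (fun w => W w * normal_fun (f w) s y)).
Proof.
apply: iW.
  apply: measurableT_comp => //; apply: measurable_funM => //.
  apply: measurableT_comp => //; apply: measurable_funX => //.
  exact: measurable_funB.
move=> w; rewrite ger0_norm ?expR_ge0// expR_le1 mulNr oppr_le0.
by rewrite divr_ge0 ?sqr_ge0// mulrn_wge0 ?sqr_ge0.
Qed.

(** A Gaussian bump is a Fourier transform: [normal_fun (f w) s y] is the mean of
    [cos (x * ((y - f w) / s))] over a standard normal [x]. After Fubini, [Wcos] applies for each
    [x] with frequency [- x / s] and phase [x * y / s]. *)
Lemma orth_cos_bump (s y : R) : s != 0 ->
  \int[P]_w (W w * normal_pdf (f w) s y) = 0.
Proof.
move=> s0.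
pose g (z : T * measurableTypeR R) : \bar R :=
  (W z.1 * cos (z.2 * ((y - f z.1) / s)))%:E.
have mg : measurable_fun setT g.
  apply/measurable_EFinP; apply: measurable_funM.
    exact: measurableT_comp.
  apply: measurableT_comp; first exact: continuous_measurable_fun
    (@continuous_cos R).
  apply: measurable_funM; first exact: measurable_snd.
  apply: measurable_funM => //; apply: measurable_funB => //.
  exact: measurableT_comp.
pose Q : probability (measurableTypeR R) R := normal_prob 0 1.
have ig : (P \x Q)%E.-integrable setT g.
  apply: (@integrable_prod_bounded _ _ _ _ _ P Q _ M);
    first exact/measurable_EFinP.
  move=> z; rewrite normrM (le_trans (ler_wpM2r _ (WM _)))// ler_piMr//.
  exact: cos_max.
have -> : \int[P]_w (W w * normal_pdf (f w) s y) =
    normal_peak s * \int[P]_w (W w * normal_fun (f w) s y).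
  rewrite -RintegralZl//.
  by apply: eq_Rintegral => w _; rewrite normal_pdfE// mulrCA.
rewrite (_ : Rintegral _ _ _ = 0) ?mulr0//.
have := Fubini ig.
have -> : (\int[P]_x \int[Q]_y0 g (x, y0) =
  \int[P]_x (W x * normal_fun (f x) s y)%:E)%E.
  apply: eq_integral => w _; rewrite /g/=.
  under eq_integral do rewrite EFinM mulrC -[X in cos X]addr0.
  set t := (y - f w) / s.
  have ic : Q.-integrable setT (EFin \o (fun x => cos (t * x + 0))).
    apply: (normal_prob_integrable_le1 (oner_neq0 R) (K := 1)) => [|x].
      apply: measurableT_comp; first exact: continuous_measurable_fun
        (@continuous_cos R).
      by apply: measurable_funD => //; exact: measurable_funM.
    by rewrite mul1r (le_trans (cos_max _))// lerDl.
  rewrite integralZl//.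
  have -> : (\int[Q]_x (cos (t * x + 0))%:E = (expR (- (t ^+ 2 / 2)))%:E)%E.
    rewrite -[LHS]fineK; last exact: integrable_fin_num.
    congr EFin; rewrite [LHS](normal_prob_cos 0 (oner_neq0 R)).
    by rewrite expr1n mulr1 cos0 mulr1.
  rewrite -EFinM /normal_fun; congr (_ * expR _)%:E.
  by rewrite /t; field.
have -> : (\int[Q]_y0 \int[P]_x g (x, y0) = 0)%E.
  rewrite -[RHS](integral0 Q setT); apply: eq_integral => x _.
  rewrite -[RHS]/(0%R%:E) -(Wcos (- x / s) (x * y / s)) /Rintegral fineK.
    by apply: eq_integral => w _; rewrite /g/=; congr ((_ * cos _)%:E); field.
  apply: integrable_fin_num => //; apply: iW => // w.
  exact: cos_max.
by rewrite /Rintegral => ->.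
Qed.

Let s_ n : R := harmonic n ^+ 2.
Let t_ (t : R) n : R := t + harmonic n.
Let s_neq0 n : s_ n != 0.
Proof. by rewrite expf_neq0// invr_eq0 pnatr_eq0. Qed.

(** A smoothed version of the indicator of [f w <= t]. *)
Let H t n w := fine (normal_prob (f w) (s_ n) `]-oo, (t_ t n)]).

(** Integrating out [z.2] gives [W * H]; integrating out [z.1] gives zero by [orth_cos_bump]. Fubini
    then makes [W] orthogonal to [H]. *)
Let F t n (z : T * measurableTypeR R) : R :=
  W z.1 * normal_pdf (f z.1) (s_ n) z.2 * (z.2 <= t_ t n)%R%:R.

Let mF t n : measurable_fun setT (F t n).
Proof.
rewrite /F; under eq_fun do rewrite normal_pdfE//.
apply: measurable_funM.
  apply: measurable_funM; first exact: measurableT_comp.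
  apply: measurable_funM => //.
  apply: measurableT_comp => //; apply: measurable_funM => //.
  apply: measurableT_comp => //; apply: measurable_funX => //.
  by apply: measurable_funB => //; exact: measurableT_comp.
exact: (measurable_fun_le_indic _ (@measurable_snd _ _ T (measurableTypeR R))).
Qed.

(** Lebesgue measure being infinite, the bound must decay in [z.2]; the density is kept because its
    integral is one. *)
Let FM t n z : `|F t n z| <= M * normal_pdf (f z.1) (s_ n) z.2.
Proof.
rewrite !normrM (ger0_norm (normal_pdf_ge0 _ _ _)) -[leRHS]mulr1 ler_pM//.
- exact: mulr_ge0 (normr_ge0 _) (normal_pdf_ge0 _ _ _).
- exact: ler_wpM2r (normal_pdf_ge0 _ _ _) _ _ (WM _).
- by case: (z.2 <= _); rewrite /= ?normr1 ?normr0.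
Qed.

Let iF t n : (P \x mu)%E.-integrable setT (EFin \o F t n).
Proof.
apply/integrable12ltyP; first exact/measurable_EFinP.
apply: (@le_lt_trans _ _ (\int[P]_x (cst M%:E) x)%E); last first.
  by rewrite integral_cst//= probability_setT mule1 ltry.
have mag : measurable_fun setT (fun z => `|(EFin \o F t n) z|%E).
  by apply: measurableT_comp => //; exact/measurable_EFinP.
apply: ge0_le_integral => //.
- by move=> x _; exact: integral_ge0.
- exact: (@measurable_fun_fubini_tonelli_F _ _ _ _ R mu _ mag (fun=> abse_ge0
    _)).
- move=> x _; rewrite /= -[leRHS]mule1 -(integral_normal_pdf (f x) (s_ n)).
  rewrite -integralZl//; last exact: integrable_normal_pdf.
  apply: ge0_le_integral => //.
  + exact: (measurableT_comp mag (pair1_measurable x)).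
  + apply/measurable_EFinP; apply: measurable_funM => //.
    exact: measurable_normal_pdf.
  + by move=> y _; rewrite -EFinM lee_fin; exact: FM.
Qed.

Let intF1 t n w : (\int[mu]_y (F t n (w, y))%:E = (W w * H t n w)%:E)%E.
Proof.
rewrite EFinM /H fineK ?fin_num_measure// /normal_prob -integralZl//;
  last first.
  exact: integrableS (integrable_normal_pdf _ _).
rewrite [RHS]integral_mkcond; apply: eq_integral => y _.
rewrite patchE /F/=; case: ifPn; rewrite ?inE ?notin_setE/= in_itv/=.
  by move=> ->; rewrite mulr1 EFinM.
by move=> /negP/negbTE ->; rewrite mulr0.
Qed.

Let intF2 t n : (\int[P]_w (W w * H t n w)%:E = 0)%E.
Proof.
under eq_integral do rewrite -(intF1 t n).
rewrite (Fubini (iF t n)) -[RHS](integral0 mu setT); apply: eq_integral => y _.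
rewrite /F/=.
have ib : P.-integrable setT (EFin \o (fun w => W w * normal_pdf (f w) (s_ n)
  y)).
  rewrite (_ : (fun w => _) = (fun w => normal_peak (s_ n) * (W w * normal_fun
    (f w) (s_ n) y))); last first.
    by apply/funext => w; rewrite normal_pdfE// mulrCA.
  by have := integrableZl measurableT (normal_peak (s_ n)) (iWn (s_ n) y);
    apply: eq_integrable.
under eq_integral do rewrite EFinM.
rewrite integralZr// (_ : integral _ _ _ = 0%E) ?mul0e//.
by rewrite -[LHS]fineK; [congr EFin;
  exact: orth_cos_bump|exact: integrable_fin_num].
Qed.

(** [H] converges pointwise to the indicator, also where [f w = t], and [W * H] is bounded by
    [M]. *)
Lemma orth_cos_halfline t : \int[P]_w (W w * (f w <= t)%R%:R) = 0.
Proof.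
have H01 n w : 0 <= H t n w <= 1.
  rewrite /H fine_ge0//= -lee_fin fineK ?fin_num_measure//.
  exact: probability_le1.
have [|||||_ _] := @dominated_convergence _ _ R P setT measurableT
  (fun n w => (W w * H t n w)%:E) (fun w => (W w * (f w <= t)%R%:R)%:E) (cst
    M%:E).
- move=> n.
  rewrite (_ : (fun w => _) = fubini_F mu (EFin \o F t n)).
    exact: measurable_fubini_F (iF t n).
  by apply/funext => w; rewrite -intF1.
- apply/measurable_EFinP; apply: measurable_funM => //.
  exact: measurable_fun_le_indic.
- apply: aeW => w _; apply: cvg_EFin; first exact: nearW.
  apply: cvgM; first exact: cvg_cst.
  exact: cvg_normal_prob_halfline.
- exact: finite_measure_integrable_cst.
- apply: aeW => w n _; rewrite /= lee_fin normrM.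
  rewrite (le_trans (ler_wpM2r _ (WM w)))// ler_piMr//.
  by have /andP[h0 h1] := H01 n w; rewrite ger0_norm.
under eq_fun do rewrite intF2.
by move=> /cvg_lim/= => /(_ (@ereal_hausdorff R)); rewrite lim_cst//;
  rewrite /Rintegral => <-.
Qed.

End halfline.

(** * From half-lines to generated sigma-algebras *)

Section dynkin_orthogonal.
Context {disp : measure_display} {T : measurableType disp} {R : realType}.
Variable P : probability T R.

Lemma integral_indic_mul (W : T -> R) (B : set T) :
  (\int[P]_(w in B) (W w)%:E = \int[P]_w (W w * \1_B w)%:E)%E.
Proof.
rewrite integral_mkcond; apply: eq_integral => w _.
by rewrite patchE indicE; case: ifPn => _; rewrite ?mulr1 ?mulr0.
Qed.

Lemma bounded_integrable (f : T -> R) (M : R) : measurable_fun setT f ->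
  (forall w, `|f w| <= M) -> P.-integrable setT (EFin \o f).
Proof.
move=> mf fM; apply: (@le_integrable _ _ _ P _ _ _ (EFin \o cst M)) => //.
- exact/measurable_EFinP.
- by move=> w _; rewrite lee_fin [leRHS]ger0_norm// (le_trans _ (fM w)).
- exact: finite_measure_integrable_cst.
Qed.

Lemma Rintegral0E (f : T -> R) : P.-integrable setT (EFin \o f) ->
  \int[P]_w f w = 0 -> (\int[P]_w (f w)%:E = 0)%E.
Proof.
move=> intf; rewrite /Rintegral => f0.
by rewrite -[LHS]fineK ?f0//; exact: integrable_fin_num.
Qed.

(** The measurable sets over which [W] integrates to zero form a Dynkin class; closure under
    complement comes from the total integral being zero. *)
Lemma dynkin_orthogonal (W : T -> R) (G : set (set T)) :
  P.-integrable setT (EFin \o W) -> (\int[P]_w (W w)%:E = 0)%E ->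
  setI_closed G -> G `<=` measurable ->
  (forall B, G B -> (\int[P]_(w in B) (W w)%:E = 0)%E) ->
  forall B, <<s G >> B -> (\int[P]_(w in B) (W w)%:E = 0)%E.
Proof.
move=> iW W0 GI Gm GW B; rewrite -(setI_closed_g_dynkin_g_sigma_algebra GI).
pose D : set (set T) := [set B | measurable B /\ (\int[P]_(w in B) (W w)%:E =
  0)%E].
suff DD : dynkin D.
  move=> GB; have /(_ B GB) [//] : <<d G >> `<=` D.
  by apply: smallest_sub => // A GA; split; [exact: Gm|exact: GW].
have iWS A : measurable A -> P.-integrable A (EFin \o W).
  by move=> mA; apply: integrableS iW.
split.
- by split.
- move=> A [mA A0]; split; first exact: measurableC.
  have := @integral_setU_EFin _ _ _ P A (~` A) W mA (measurableC mA).
  rewrite setUv W0 A0 add0e => ->//.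
  + by apply/measurable_EFinP; exact: (measurable_int _ iW).
  + by apply/disj_setPCl.
- move=> F tF DF; split; first by apply: bigcup_measurable => n _;
    have [] := DF n.
  rewrite integral_bigcup//; first by apply: eseries0 => n _ _; have [] := DF n.
  + by move=> n; have [] := DF n.
  + by apply: iWS; apply: bigcup_measurable => n _; have [] := DF n.
Qed.

End dynkin_orthogonal.

Section subspaces.
Context {T : Type} {R : realType}.

Definition subspace (L : set (T -> R)) : Prop :=
  L (cst 0) /\ forall a f g, L f -> L g -> L (fun w => a * f w + g w).

(** Finite intersections of half-spaces, a pi-system for the sigma-algebra generated by [L]. The
    inductive form allows half-spaces to be peeled off one at a time. *)
Inductive halfspaces (L : set (T -> R)) : set (set T) :=
| halfspacesT : halfspaces L setT
| halfspacesI f t B : L f -> halfspaces L B ->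
    halfspaces L ([set w | f w <= t] `&` B).

Lemma halfspaces_setI L : setI_closed (halfspaces L).
Proof.
move=> A B + hB; elim=> [|f t A' Lf _ IH]; first by rewrite setTI.
by rewrite -setIA; apply: halfspacesI.
Qed.

Lemma subspaceD L f g : subspace L -> L f -> L g -> L (fun w => f w + g w).
Proof.
move=> [_ LD] Lf Lg; have := LD 1 f g Lf Lg.
by congr L; apply/funext => w; rewrite mul1r.
Qed.

Lemma subspaceZ L a f : subspace L -> L f -> L (fun w => a * f w).
Proof.
move=> [L0 LD] Lf; have := LD a f _ Lf L0.
by congr L; apply/funext => w; rewrite addr0.
Qed.

Lemma subspaceB L f g : subspace L -> L f -> L g -> L (fun w => f w - g w).
Proof.
move=> [_ LD] Lf Lg; have := LD (-1) g f Lg Lf.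
by congr L; apply/funext => w; rewrite mulN1r addrC.
Qed.

End subspaces.

Section halfspaces.
Context {disp : measure_display} {T : measurableType disp} {R : realType}.
Variable P : probability T R.
Implicit Type L : set (T -> R).

Lemma halfspaces_measurable L : (forall f, L f -> measurable_fun setT f) ->
  halfspaces L `<=` measurable.
Proof.
move=> mL A; elim=> [//|f t B Lf _ mB]; apply: measurableI => //.
rewrite -[X in measurable X]setTI.
have := mL _ Lf measurableT `]-oo, t]%classic (measurable_itv _).
by rewrite [X in _ (_ `&` X)](_ : _ = [set w | f w <= t])//; apply/seteqP;
  split=> w /=; rewrite in_itv.
Qed.

(** Induction with [W] general: the indicator of one half-space is absorbed into the weight. The new
    weight is still orthogonal to all cosines, by [orth_cos_halfline] for the weight
    [W * cos (g + al)]: multiplied by a cosine of [a f], the latter splits into cosines of [a f + g]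
    and [- a f + g], both in [L]. *)
Lemma halfspaces_orthogonal L (W : T -> R) M : subspace L ->
  (forall f, L f -> measurable_fun setT f) ->
  measurable_fun setT W -> (forall w, `|W w| <= M) ->
  (forall f al, L f -> \int[P]_w (W w * cos (f w + al)) = 0) ->
  forall B, halfspaces L B -> \int[P]_w (W w * \1_B w) = 0.
Proof.
move=> [L0 LD] mL + + + B hB; elim: hB W => {B} [|f t B Lf hB IH] W mW WM WL.
  have := WL _ 0 L0; rewrite /= addr0 cos0 => <-.
  by apply: eq_Rintegral => w _; rewrite indicT.
have mcos g al : L g -> measurable_fun setT (fun w => cos (g w + al)).
  move=> /mL mg; apply: measurableT_comp;
    first exact: continuous_measurable_fun (@continuous_cos R).
  exact: measurable_funD.
have M0 : 0 <= M by apply: le_trans (WM point).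
rewrite -(IH (fun w => W w * (f w <= t)%R%:R)).
- apply: eq_Rintegral => w _; rewrite -mulrA; congr (_ * _).
  rewrite !indicE in_setI -natrM mulnb; congr ((_ && _)%:R).
  by apply/idP/idP; rewrite inE.
- by apply: measurable_funM => //; apply: measurable_fun_le_indic; exact: mL.
- move=> w; rewrite normrM (le_trans _ (WM w))// ler_piMr//.
  by case: (f w <= t); rewrite /= ?normr1 ?normr0.
- move=> g al Lg.
  rewrite -(@orth_cos_halfline _ _ _ P (fun w => W w * cos (g w + al)) f M _ _
    _ _ t).
  + by apply: eq_Rintegral => w _; rewrite mulrAC.
  + by apply: measurable_funM => //; exact: mcos.
  + by move=> w; rewrite normrM (le_trans (ler_wpM2r _ (WM w)))// ler_piMr//
      cos_max.
  + exact: mL.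
  + move=> a al'.
    have iWc h b : L h -> P.-integrable setT (EFin \o (fun w => W w * cos (h w
      + b))).
      move=> Lh; apply: (@bounded_integrable _ _ _ P _ M).
        by apply: measurable_funM => //; exact: mcos.
      by move=> w; rewrite normrM (le_trans (ler_wpM2r _ (WM w)))// ler_piMr//
        cos_max.
    have L1 : L (fun w => a * f w + g w) by exact: LD.
    have L2 : L (fun w => - a * f w + g w) by exact: LD.
    transitivity (\int[P]_w (2^-1 * (W w * cos (a * f w + g w + (al' + al)) +
        W w * cos (- a * f w + g w + (al - al'))))).
      apply: eq_Rintegral => w _.
      rewrite (_ : a * f w + g w + (al' + al) = (g w + al) + (a * f w + al'));
        last by ring.
      rewrite (_ : - a * f w + g w + (al - al') = (g w + al) - (a * f w +
        al')); last by ring.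
      by rewrite (cosD (g w + al)) (cosB (g w + al)); field.
    rewrite RintegralZl//; last first.
      by have := integrableD measurableT (iWc _ (al' + al) L1) (iWc _ (al -
        al') L2); apply: eq_integrable.
    by rewrite RintegralD ?WL ?addr0 ?mulr0//; exact: iWc.
Qed.

End halfspaces.

(** * Gaussian subspaces and independence *)

Section gaussian_space.
Context {disp : measure_display} {T : measurableType disp} {R : realType}.
Variable P : probability T R.

(** Closure under linear combinations makes every finite family in [L] jointly Gaussian. *)
Definition gaussian_space (L : set (T -> R)) : Prop :=
  subspace L /\ forall f, L f ->
    [/\ measurable_fun setT f, is_gaussian P f & \int[P]_w f w = 0].

Definition ip (f g : T -> R) : R := \int[P]_w (f w * g w).

Lemma ipC f g : ip f g = ip g f.
Proof. by apply: eq_Rintegral => w _; rewrite mulrC. Qed.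

Variable L : set (T -> R).
Hypothesis gL : gaussian_space L.

(** Polarization: [f g] is a quarter of [(f + g)^2 - (f - g)^2]. *)
Lemma gaussian_spaceM f g : L f -> L g ->
  P.-integrable setT (EFin \o (fun w => f w * g w)).
Proof.
move=> Lf Lg; have [sL HL] := gL.
have iS h : L h -> P.-integrable setT (EFin \o (fun w => h w ^+ 2)).
  by move=> /HL[mh gh _]; exact: gaussian_integrable_sqr.
have Lfg := subspaceD sL Lf Lg; have Lfg' := subspaceB sL Lf Lg.
have h := integrableZl measurableT (4^-1) (integrableB measurableT (iS _ Lfg)
  (iS _ Lfg')).
apply: eq_integrable h => // w _ /=.
by rewrite -EFinB -EFinM; congr EFin; field.
Qed.

Lemma ip_linear a f g h : L f -> L g -> L h ->
  ip (fun w => a * f w + g w) h = a * ip f h + ip g h.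
Proof.
move=> Lf Lg Lh; rewrite /ip -RintegralZl//; last exact: gaussian_spaceM.
rewrite -RintegralD//; last 2 first.
- by have := integrableZl measurableT a (gaussian_spaceM Lf Lh);
    apply: eq_integrable.
- exact: gaussian_spaceM.
by apply: eq_Rintegral => w _; rewrite mulrDl mulrA.
Qed.

Lemma ip0 f : ip (cst 0) f = 0.
Proof.
by rewrite /ip; under eq_Rintegral do rewrite mul0r;
  rewrite Rintegral_cst//= mul0r.
Qed.

Lemma ipB f g h : L f -> L g -> L h ->
  ip (fun w => f w - g w) h = ip f h - ip g h.
Proof.
move=> Lf Lg Lh; rewrite addrC -mulN1r -ip_linear//; congr ip.
by apply/funext => w; rewrite mulN1r addrC.
Qed.

Lemma ipZ a f h : L f -> L h -> ip (fun w => a * f w) h = a * ip f h.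
Proof.
move=> Lf Lh; have [[L0 _] _] := gL.
rewrite -[RHS]addr0 -[X in _ + X](ip0 h) -ip_linear//; congr ip.
by apply/funext => w; rewrite addr0.
Qed.

Lemma ipD f g h : L f -> L g -> L h ->
  ip (fun w => f w + g w) h = ip f h + ip g h.
Proof.
move=> Lf Lg Lh; rewrite -[ip f h]mul1r -ip_linear//; congr ip.
by apply/funext => w; rewrite mul1r.
Qed.

Let mcos f al : L f -> measurable_fun setT (fun w => cos (f w + al)).
Proof.
move=> /gL.2[mf _ _].
apply: measurableT_comp; first exact: continuous_measurable_fun
  (@continuous_cos R).
exact: measurable_funD.
Qed.

Let icos f al : L f -> P.-integrable setT (EFin \o (fun w => cos (f w + al))).
Proof.
move=> Lf; apply: (@bounded_integrable _ _ _ P _ 1); first exact: mcos.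
by move=> w; exact: cos_max.
Qed.

Let chi f al := \int[P]_w cos (f w + al).

Let chiE f al : L f -> chi f al = expR (- (ip f f / 2)) * cos al.
Proof. by move=> /gL.2[mf gf f0]; rewrite /chi gaussian_char. Qed.

(** The product is half the sum of cosines of [f + g] and [f - g]. By orthogonality both have square
    norm [ip f f + ip g g], so the exponential factors out and the phases recombine into
    [cos al * cos be]. *)
Let cos_uncorrelated f g al be : L f -> L g -> ip f g = 0 ->
  \int[P]_w (cos (f w + al) * cos (g w + be)) = chi f al * chi g be.
Proof.
move=> Lf Lg fg; have sL := gL.1.
have Lp := subspaceD sL Lf Lg; have Lm := subspaceB sL Lf Lg.
transitivity (\int[P]_w (2^-1 * (cos (f w + g w + (al + be)) +
    cos (f w - g w + (al - be))))).
  apply: eq_Rintegral => w _.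
  rewrite (_ : f w + g w + (al + be) = (f w + al) + (g w + be)); last by ring.
  rewrite (_ : f w - g w + (al - be) = (f w + al) - (g w + be)); last by ring.
  by rewrite (cosD (f w + al)) (cosB (f w + al)); field.
rewrite RintegralZl//; last first.
  by have := integrableD measurableT (icos (al + be) Lp) (icos (al - be) Lm);
    apply: eq_integrable.
rewrite RintegralD//; [|exact: icos..].
rewrite -!/(chi _ _) !chiE// !ipB// !ipD//.
rewrite ![ip _ (fun w => f w + g w)]ipC ![ip _ (fun w => f w - g w)]ipC.
rewrite !ipB// !ipD// [ip g f]ipC fg !addr0 !sub0r !subr0 !add0r opprK.
by rewrite mulrDl opprD expRD cosD cosB; field.
Qed.

(** Cosines are traded for events one side at a time: [stepU] makes centred cosines of [V] integrate
    to zero over an event of [U], and then the centred indicator of that event serves as the weight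
    for [V]. *)
Lemma gaussian_independent U V : U `<=` L -> V `<=` L -> subspace U ->
  subspace V -> (forall u v, U u -> V v -> ip u v = 0) ->
  forall A B, <<s halfspaces U >> A -> <<s halfspaces V >> B ->
  P (A `&` B) = (P A * P B)%E.
Proof.
move=> UL VL sU sV UV A B hA hB.
have mU u : U u -> measurable_fun setT u by move=> /UL/gL.2[].
have mV v : V v -> measurable_fun setT v by move=> /VL/gL.2[].
have smeas K : (forall u, K u -> measurable_fun setT u) ->
    <<s halfspaces K >> `<=` @measurable _ T.
  move=> mK; apply: smallest_sub; first exact: sigma_algebra_measurable.
  exact: halfspaces_measurable.
have mA : measurable A by exact: smeas hA.
have mB : measurable B by exact: smeas hB.
have stepU v be : V v ->
    (\int[P]_(w in A) (cos (v w + be) - chi v be)%:E = 0)%E.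
  move=> Vv; have Lv := VL _ Vv.
  pose W w := cos (v w + be) - chi v be.
  have c1 : `|chi v be| <= 1.
    rewrite (le_trans (le_normr_Rintegral measurableT (icos _ Lv)))//.
    rewrite (@le_trans _ _ (\int[P]_w (cst 1 w)))//; last first.
      by rewrite Rintegral_cst//= probability_setT mulr1.
    apply: le_Rintegral => //.
    - exact: integrable_norm (icos _ Lv).
    - exact: finite_measure_integrable_cst.
    - by move=> w _; exact: cos_max.
  have mW : measurable_fun setT W by apply: measurable_funB => //; exact: mcos.
  have W2 w : `|W w| <= 2.
    rewrite (le_trans (ler_normB _ _))// -[2]/(1 + 1) lerD//; exact: cos_max.
  have iW := bounded_integrable P mW W2.
  have W0 : \int[P]_w W w = 0.
    rewrite RintegralB//; [|exact: icos|exact: finite_measure_integrable_cst].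
    by rewrite Rintegral_cst//= probability_setT mulr1 subrr.
  apply: (dynkin_orthogonal iW (Rintegral0E iW W0) _ _ _ hA).
  - exact: halfspaces_setI.
  - exact: halfspaces_measurable.
  - move=> C hC; rewrite integral_indic_mul; apply: Rintegral0E.
      apply: (@bounded_integrable _ _ _ P _ 2).
        apply: measurable_funM => //; apply: measurable_indic.
        exact: halfspaces_measurable hC.
      move=> w; rewrite normrM (le_trans _ (W2 w))// ler_piMr// indicE.
      by case: (w \in C); rewrite /= ?normr1 ?normr0.
    apply: (@halfspaces_orthogonal _ _ _ P U W 2) => // u al Uu.
    have Lu := UL _ Uu.
    rewrite /W; under eq_Rintegral do rewrite mulrBl.
    rewrite RintegralB//; last 2 first.
    - apply: (@bounded_integrable _ _ _ P _ 1).
        by apply: measurable_funM; exact: mcos.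
      by move=> w; rewrite normrM mulr_ile1// cos_max.
    - by have := integrableZl measurableT (chi v be) (icos al Lu);
        apply: eq_integrable.
    rewrite RintegralZl//; last exact: icos.
    by rewrite cos_uncorrelated ?subrr// ipC UV.
(* By [stepU] this weight is orthogonal to the cosines of [V], hence integrates to zero over every
   event generated by [V]. *)
pose W w : R := \1_A w - fine (P A).
have PA1 : `|fine (P A)| <= 1.
  by rewrite ger0_norm ?fine_ge0// -lee_fin fineK ?fin_num_measure//
    probability_le1.
have mW : measurable_fun setT W by apply: measurable_funB => //;
  exact: measurable_indic.
have W2 w : `|W w| <= 2.
  rewrite (le_trans (ler_normB _ _))// -[2]/(1 + 1) lerD// indicE.
  by case: (w \in A); rewrite /= ?normr1 ?normr0.
have iW := bounded_integrable P mW W2.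
have iA : P.-integrable setT (EFin \o (\1_A : T -> R))
  by exact: integrable_indic.
have W0 : \int[P]_w W w = 0.
  rewrite RintegralB//; last exact: finite_measure_integrable_cst.
  rewrite Rintegral_cst//= probability_setT mulr1.
  by rewrite /Rintegral integral_indic// setIT subrr.
have GW C : halfspaces V C -> (\int[P]_(w in C) (W w)%:E = 0)%E.
  move=> hC; rewrite integral_indic_mul; apply: Rintegral0E.
    apply: (@bounded_integrable _ _ _ P _ 2).
      apply: measurable_funM => //; apply: measurable_indic.
      exact: halfspaces_measurable hC.
    move=> w; rewrite normrM (le_trans _ (W2 w))// ler_piMr// indicE.
    by case: (w \in C); rewrite /= ?normr1 ?normr0.
  apply: (@halfspaces_orthogonal _ _ _ P V W 2) => // v be Vv.
  have Lv := VL _ Vv.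
  have iAc : P.-integrable setT (EFin \o (fun w => (cos (v w + be) - chi v be)
    * \1_A w)).
    apply: (@bounded_integrable _ _ _ P _ (1 + `|chi v be|)).
      by apply: measurable_funM => //; apply: measurable_funB => //;
        exact: mcos.
    move=> w; rewrite normrM (@le_trans _ _ (`|cos (v w + be) - chi v be|))//.
      by rewrite ler_piMr// indicE; case: (w \in A); rewrite /= ?normr1 ?normr0.
    by rewrite (le_trans (ler_normB _ _))// lerD2r cos_max.
  have icA := integrableZl measurableT (chi v be) iA.
  have iPc := integrableZl measurableT (fine (P A)) (icos be Lv).
  transitivity (\int[P]_w ((cos (v w + be) - chi v be) * \1_A w +
      (chi v be * \1_A w - fine (P A) * cos (v w + be)))).
    by apply: eq_Rintegral => w _; rewrite /W; ring.
  rewrite RintegralD//; last first.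
    by have := integrableB measurableT icA iPc; apply: eq_integrable.
  rewrite RintegralB// ?RintegralZl//; last exact: icos.
  have -> : \int[P]_w ((cos (v w + be) - chi v be) * \1_A w) = 0.
    by have := stepU v be Vv; rewrite integral_indic_mul /Rintegral => ->.
  by rewrite add0r [X in _ * X - _]/Rintegral integral_indic// setIT mulrC
    subrr.
have := dynkin_orthogonal iW (Rintegral0E iW W0) (@halfspaces_setI _ _ V)
  (halfspaces_measurable mV) GW hB.
rewrite integralB_EFin//; last 2 first.
- exact: integrableS iA.
- exact: finite_measure_integrable_cst.
rewrite integral_indic// integral_cst// fineK ?fin_num_measure//.
have fAB : (P A * P B)%E \is a fin_num by rewrite fin_numM// fin_num_measure.
move=> /eqP; rewrite sube_eq ?add0e//; first by move=> /eqP.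
by rewrite fin_num_measure//; exact: measurableI.
Qed.

End gaussian_space.

(** * Conditional probabilities *)

Lemma measurable_fun_halfline d (T : measurableType d) (R : realType)
    (f : T -> R) : (forall t, measurable [set w | f w <= t]) ->
  measurable_fun setT f.
Proof.
move=> H; apply: (measurability _ (RGenOInfty.measurableE R)).
move=> _ [_ [t ->] <-]; rewrite setTI.
rewrite (_ : _ @^-1` _ = ~` [set w | f w <= t]); first exact: measurableC.
by apply/seteqP; split=> w /=; rewrite in_itv/= andbT ltNge => /negP.
Qed.

Lemma gaussian_halfspace_measurable (T : pointedType) (R : realType)
    (L : set (T -> R)) f : L f ->
  measurable_fun setT (f : g_sigma_algebraType (halfspaces L) -> R).
Proof.
move=> Lf; apply: measurable_fun_halfline => t; apply: sub_sigma_algebra.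
rewrite -[X in halfspaces L X]setIT.
by apply: halfspacesI => //; exact: halfspacesT.
Qed.

Section sub_probability.
Context {disp : measure_display} {T : measurableType disp} {R : realType}.
Variables (P : probability T R) (G : set (set T)).
Hypothesis GM : G `<=` measurable.

Lemma g_sigma_measurable : <<s G >> `<=` @measurable _ T.
Proof. by apply: smallest_sub => //; exact: sigma_algebra_measurable. Qed.

(** The identity as a map to the coarser measurable space; the image of [P] under it is the
    restriction of [P] to the sigma-algebra generated by [G]. *)
Definition to_sub (w : T) : g_sigma_algebraType G := w.

Lemma measurable_to_sub : measurable_fun setT to_sub.
Proof. by move=> _ B /g_sigma_measurable; rewrite setTI. Qed.

Definition sub_prob : probability (g_sigma_algebraType G) R :=
  distribution P (HB.pack to_sub
    (isMeasurableFun.Build _ _ _ _ to_sub measurable_to_sub) :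
    {mfun T >-> g_sigma_algebraType G}).

Lemma measurable_sub (f : T -> R) :
  measurable_fun setT (f : g_sigma_algebraType G -> R) -> measurable_fun setT f.
Proof. by move=> mf; have := measurableT_comp mf measurable_to_sub. Qed.

(** Both versions have equal integrals over the sets of the sub-sigma-algebra only, so they are
    compared under the restricted probability; its null sets are null for [P]. *)
Lemma is_cond_prob_ae A f g : is_cond_prob P G A f -> is_cond_prob P G A g ->
  f = g %[ae P].
Proof.
move=> [mf intf fE] [mg intg gE].
have intsub h : measurable_fun setT (h : g_sigma_algebraType G -> R) ->
    P.-integrable setT (EFin \o h) -> forall B, <<s G >> B ->
    sub_prob.-integrable B (EFin \o h) /\
    (\int[sub_prob]_(w in B) (h w)%:E = \int[P]_(w in B) (h w)%:E)%E.
  move=> mh inth B mB; have inthB : P.-integrable B (EFin \o h).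
    by apply: integrableS inth => //; exact: g_sigma_measurable.
  have mEh : measurable_fun setT (EFin \o (h : g_sigma_algebraType G -> R)).
    exact/measurable_EFinP.
  split; first exact: (integrable_pushforward measurable_to_sub mEh inthB mB).
  exact: (integral_pushforward measurable_to_sub mEh inthB mB).
have GT : <<s G >> setT by exact: (@measurableT _ (g_sigma_algebraType G)).
have : ae_eq sub_prob setT (EFin \o f) (EFin \o g).
  apply: integral_ae_eq => //.
  - exact: (intsub _ mf intf _ GT).1.
  - exact/measurable_EFinP.
  - move=> B _ mB; rewrite (intsub _ mf intf _ mB).2 (intsub _ mg intg _ mB).2.
    by rewrite fE// gE.
move=> [N [mN N0 HN]]; exists N; split => //.
  exact: g_sigma_measurable.
move=> w h; apply: HN => /= h'; apply: h => /=.
by move=> _; have [] := h' I.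
Qed.

End sub_probability.

Section independence.
Context {disp : measure_display} {T : measurableType disp} {R : realType}.
Variable P : probability T R.

Lemma independent_dynkin (E : set T) (G : set (set T)) : measurable E ->
  setI_closed G -> G `<=` measurable ->
  (forall C, G C -> P (C `&` E) = (P C * P E)%E) ->
  forall C, <<s G >> C -> P (C `&` E) = (P C * P E)%E.
Proof.
move=> mE GI GM GE C hC.
pose W w : R := \1_E w - fine (P E).
have iE : P.-integrable setT (EFin \o (\1_E : T -> R))
  by exact: integrable_indic.
have ic : P.-integrable setT (EFin \o cst (fine (P E))).
  exact: finite_measure_integrable_cst.
have iW : P.-integrable setT (EFin \o W).
  by have := integrableB measurableT iE ic; apply: eq_integrable.
have WE B : measurable B -> (\int[P]_(w in B) (W w)%:E = P (B `&` E) - P B * P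
  E)%E.
  move=> mB; rewrite integralB_EFin//; last 2 first.
  - exact: integrableS iE.
  - exact: integrableS ic.
  by rewrite integral_indic// integral_cst// fineK ?fin_num_measure// setIC [X
    in (_ - X)%E]muleC.
have fPP B : measurable B -> (P B * P E)%E \is a fin_num.
  by move=> mB; rewrite fin_numM// fin_num_measure.
have mC : measurable C by exact: (g_sigma_measurable GM).
have /eqP : (\int[P]_(w in C) (W w)%:E = 0)%E.
  apply: (dynkin_orthogonal iW _ GI GM _ hC).
    by rewrite WE// setTI probability_setT mul1e subee// fin_num_measure.
  by move=> B GB; rewrite WE ?GE ?subee ?fPP//; exact: GM.
rewrite WE// sube_eq ?add0e ?fPP//; first by move=> /eqP.
by rewrite fin_num_measure//; exact: measurableI.
Qed.

(** The joint law is a product, so Fubini applies. No Gaussian structure is assumed, since one use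
    has a conditional CDF and an indicator as factors. *)
Lemma independent_expectation (X Y : T -> R) :
  P.-integrable setT (EFin \o X) -> P.-integrable setT (EFin \o Y) ->
  P.-integrable setT (EFin \o (fun w => X w * Y w)) ->
  (forall A B, measurable A -> measurable B ->
    P (X @^-1` A `&` Y @^-1` B) = (P (X @^-1` A) * P (Y @^-1` B))%E) ->
  \int[P]_w (X w * Y w) = \int[P]_w X w * \int[P]_w Y w.
Proof.
move=> iX iY iXY XY.
have mX : measurable_fun setT X by have /integrableP[/measurable_EFinP] := iX.
have mY : measurable_fun setT Y by have /integrableP[/measurable_EFinP] := iY.
pose X' : {mfun T >-> R} := HB.pack X (isMeasurableFun.Build _ _ _ _ _ mX).
pose Y' : {mfun T >-> R} := HB.pack Y (isMeasurableFun.Build _ _ _ _ _ mY).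
have mZ : measurable_fun setT (fun w => (X w, Y w))
  by exact: measurable_fun_pair.
pose Z : {mfun T >-> (R * R)%type} := HB.pack (fun w => (X w, Y w))
  (isMeasurableFun.Build _ _ _ _ _ mZ).
pose PX := distribution P X'. pose PY := distribution P Y'. pose PZ :=
  distribution P Z.
have PXY C : measurable C -> (PX \x PY)%E C = PZ C.
  by apply: product_measure_unique => A B mA mB; rewrite -XY.
pose m (z : R * R) : \bar R := (z.1 * z.2)%:E.
have mm : measurable_fun setT m.
  apply/measurable_EFinP; apply: (@measurable_funM _ (R * R)%type R setT fst
    snd).
    exact: measurable_fst.
  exact: measurable_snd.
have mid : measurable_fun setT (EFin \o (id : R -> R))
  by exact/measurable_EFinP.
have iZm : PZ.-integrable setT m.
  exact: (integrable_pushforward mZ mm iXY measurableT).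
have im : (PX \x PY)%E.-integrable setT m.
  apply/integrableP; split=> //; have /integrableP[_] := iZm.
  by rewrite (eq_measure_integral (PX \x PY)%E)//; move=> C mC _;
    exact/esym/PXY.
have iPY : PY.-integrable setT (EFin \o id).
  exact: (integrable_pushforward mY mid iY measurableT).
have iPX : PX.-integrable setT (EFin \o id).
  exact: (integrable_pushforward mX mid iX measurableT).
have eX : \int[P]_w X w = \int[PX]_x x.
  by congr fine; rewrite (integral_pushforward mX mid iX measurableT).
have eY : \int[P]_w Y w = \int[PY]_x x.
  by congr fine; rewrite (integral_pushforward mY mid iY measurableT).
rewrite eX eY -RintegralZr//; congr fine.
transitivity (\int[PZ]_z m z)%E;
  first by rewrite (integral_pushforward mZ mm iXY measurableT).
rewrite (eq_measure_integral (PX \x PY)%E); last by move=> C mC _;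
  exact/esym/PXY.
rewrite -integral12_prod_meas1//.
apply: (@eq_integral _ _ R PX setT) => x _.
rewrite /fubini_F /m/=; under eq_integral do rewrite EFinM.
rewrite (@integralZl _ _ R PY setT measurableT _ iPY) EFinM fineK//.
exact: (integrable_fin_num measurableT iPY).
Qed.

End independence.

(** * Orthogonal projections *)

Section lin.
Context {T : Type} {R : realType} {J : finType}.
Implicit Type u : J -> T -> R.

Definition lin u : set (T -> R) :=
  [set f | exists a : J -> R, f = fun w => \sum_j a j * u j w].

Lemma lin_subspace u : subspace (lin u).
Proof.
split.
  by exists (fun=> 0); apply/funext => w; rewrite big1// => j _; rewrite mul0r.
move=> a f g [b ->] [c ->]; exists (fun j => a * b j + c j).
apply/funext => w; rewrite mulr_sumr -big_split/=.
by apply: eq_bigr => j _; rewrite mulrDl mulrA.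
Qed.

Lemma lin_gen u j : lin u (u j).
Proof.
exists (fun i => (i == j)%:R); apply/funext => w.
rewrite (bigD1 j)//= eqxx mul1r big1 ?addr0// => i /negbTE ->.
by rewrite mul0r.
Qed.

Lemma lin_min u (V : set (T -> R)) : subspace V -> (forall j, V (u j)) ->
  lin u `<=` V.
Proof.
move=> sV Vu _ [a ->]; elim: (index_enum J) => [|j s IH].
  by under eq_fun do rewrite big_nil; exact: sV.1.
by under eq_fun do rewrite big_cons; exact: sV.2.
Qed.

End lin.

Section projection.
Context {disp : measure_display} {T : measurableType disp} {R : realType}.
Variable P : probability T R.

Lemma gaussian_space_lin (J : finType) (u : J -> T -> R) :
  (forall j, measurable_fun setT (u j)) -> jointly_gaussian P u ->
  (forall j, ('E_P[u j] = 0)%E) -> gaussian_space P (lin u).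
Proof.
move=> mu gu u0; split; first exact: lin_subspace.
have gl f : lin u f -> is_gaussian P f by move=> [a ->]; exact: gu.
have ml f : lin u f -> measurable_fun setT f.
  move=> [a ->]; apply: measurable_sum => j; exact: measurable_funM.
move=> f uf; split; [exact: ml|exact: gl|].
pose V : set (T -> R) :=
  [set f : T -> R | P.-integrable setT (EFin \o f) /\ \int[P]_w f w = 0].
suff [] : V f by [].
apply: lin_min uf => [|j]; last first.
  split; first by apply: gaussian_integrable => //; apply: gl; exact: lin_gen.
  by have := u0 j; rewrite unlock /Rintegral => ->.
split.
  split; first exact: finite_measure_integrable_cst.
  by rewrite Rintegral_cst//= mul0r.
move=> a g h [ig g0] [ih h0].
have iag : P.-integrable setT (EFin \o (fun w => a * g w)).
  by have := integrableZl measurableT a ig; apply: eq_integrable.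
split; last by rewrite RintegralD// RintegralZl// g0 h0 mulr0 addr0.
by have := integrableD measurableT iag ih; apply: eq_integrable.
Qed.

Variable L : set (T -> R).
Hypothesis gL : gaussian_space P L.

(** The degenerate case of Cauchy-Schwarz; elements of [L] are functions rather than classes, so a
    vanishing norm does not give [f = 0]. *)
Lemma ip_degenerate f g : L f -> L g -> ip P f f = 0 -> ip P g f = 0.
Proof.
move=> Lf Lg ff; apply/eqP/negPn/negP => gf.
(* chosen so that [g + a f] has square norm [-1] *)
pose a := - (ip P g g + 1) / (2 * ip P g f).
have Lh : L (fun w => a * f w + g w) by apply: gL.1.2.
have : 0 <= ip P (fun w => a * f w + g w) (fun w => a * f w + g w).
  by apply: Rintegral_ge0 => w _; rewrite -expr2 sqr_ge0.
rewrite (ip_linear gL)// ![ip P _ (fun w => a * f w + g w)]ipC.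
rewrite !(ip_linear gL)// [ip P f g]ipC ff /a.
have -> : - (ip P g g + 1) / (2 * ip P g f) *
  (- (ip P g g + 1) / (2 * ip P g f) * 0 + ip P g f) +
  (- (ip P g g + 1) / (2 * ip P g f) * ip P g f + ip P g g) = - 1 by field.
by rewrite oppr_ge0 ler10.
Qed.

Lemma ip_subspace f : L f -> subspace [set g | L g /\ ip P f g = 0].
Proof.
move=> Lf; split; first by split; [exact: gL.1.1|rewrite ipC ip0].
move=> a g h [Lg fg] [Lh fh]; split; first exact: gL.1.2.
by rewrite ipC (ip_linear gL)// ![ip P _ f]ipC fg fh mulr0 addr0.
Qed.

Lemma projection (J : finType) (u : J -> T -> R) g :
  (forall j, L (u j)) -> L g ->
  exists2 h, lin u h & forall f, lin u f -> ip P (fun w => g w - h w) f = 0.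
Proof.
move=> Lu Lg.
(* Gram-Schmidt on the list of generators. Lying in the span of a list is expressed as lying in
   every subspace that contains its members, which suits the induction. *)
suff [h [hu gh]] : exists h, (forall V, subspace V ->
    (forall j, j \in index_enum J -> V (u j)) -> V h) /\
    forall j, j \in index_enum J -> ip P (fun w => g w - h w) (u j) = 0.
  exists h; first by apply: hu; [exact: lin_subspace|move=> j _;
    exact: lin_gen].
  have Lh : L h by apply: hu; [exact: gL.1|].
  have Lgh := subspaceB gL.1 Lg Lh.
  move=> f uf; suff [] : [set f | L f /\ ip P (fun w => g w - h w) f = 0] f
    by [].
  apply: lin_min uf; first exact: ip_subspace.
  by move=> j; split => //; apply: gh; rewrite mem_index_enum.
elim: (index_enum J) g Lg => [g Lg|j0 s IH g Lg].
  by exists (cst 0); split=> // V [].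
have Lj0 := Lu j0.
have [hf [hfV hf0]] := IH _ Lj0.
have [hg [hgV hg0]] := IH _ Lg.
have Lhf : L hf by apply: hfV; [exact: gL.1|].
have Lhg : L hg by apply: hgV; [exact: gL.1|].
(* The residuals of the new generator and of [g] against the tail; the projection of [g] grows by a
   multiple of [f']. *)
pose f' w := u j0 w - hf w; pose g' w := g w - hg w.
have Lf' : L f' by exact: subspaceB gL.1 _ _.
have Lg' : L g' by exact: subspaceB gL.1 _ _.
(* [c = 0] if [ip P f' f' = 0]; then [ip P g' f' = 0] too *)
pose c := ip P g' f' / ip P f' f'.
have Lcf : L (fun w => c * f' w) by exact: subspaceZ gL.1 _.
have key k : L k -> ip P (fun w => g w - (c * f' w + hg w)) k = ip P g' k - c *
  ip P f' k.
  move=> Lk; rewrite -(ipZ gL)// -(ipB gL)//; congr ip; apply/funext => w.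
  by rewrite /g'; ring.
exists (fun w => c * f' w + hg w); split=> [V sV Vs|j].
  have Vhf : V hf by apply: hfV => // j js; apply: Vs; rewrite inE js orbT.
  have Vhg : V hg by apply: hgV => // j js; apply: Vs; rewrite inE js orbT.
  apply: sV.2 => //; apply: subspaceB => //; apply: Vs.
  by rewrite inE eqxx.
have ks i : i \in s -> ip P g' (u i) - c * ip P f' (u i) = 0.
  by move=> si; rewrite hg0// hf0// mulr0 subrr.
rewrite inE => /predU1P[->|js]; rewrite key//; last exact: ks.
(* As [u j0 = f' + hf] and [g' - c * f'] is orthogonal to [hf], only orthogonality to [f'] remains,
   which is the choice of [c]. *)
have Lgc : L (fun w => g' w - c * f' w) by exact: subspaceB gL.1 _ _.
have : ip P (fun w => g' w - c * f' w) hf = 0.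
  suff [] : [set k | L k /\ ip P (fun w => g' w - c * f' w) k = 0] hf by [].
  apply: hfV; first exact: ip_subspace.
  by move=> i si; split=> //; rewrite (ipB gL)// (ipZ gL)// ks.
rewrite (ipB gL)// (ipZ gL)// => /eqP; rewrite subr_eq0 => /eqP e.
have e1 k : L k -> ip P k (u j0) = ip P k f' + ip P k hf.
  move=> Lk; rewrite ![ip P k _]ipC -(ipD gL)//; congr ip; apply/funext => w.
  by rewrite /f' subrK.
rewrite !e1// e mulrDr opprD addrACA subrr addr0.
have [ff0|ff0] := eqVneq (ip P f' f') 0.
  by rewrite (ip_degenerate Lf' Lg' ff0) ff0 mulr0 subr0.
by rewrite /c divfK// subrr.
Qed.

End projection.

(** * Conditional distribution functions *)

Section conditional_cdf.
Context {disp : measure_display} {T : measurableType disp} {R : realType}.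
Context {P : probability T R} {n d : nat}.
Variable z : 'I_n -> {RV P >-> d.-tuple R}.
Implicit Type S : pred 'I_n.

Definition coord (k : 'I_n) (i : 'I_d) (w : T) : R := rvec (z k) w i 0.

Definition span S : set (T -> R) := lin (stack S z).

Lemma coordE k i : coord k i = fun w => tnth (z k w) i.
Proof. by apply/funext => w; rewrite /coord mxE. Qed.

Lemma measurable_coord k i : measurable_fun setT (coord k i).
Proof.
rewrite coordE; apply: (measurableT_comp (measurable_tnth i)).
exact: measurable_funPT.
Qed.

Lemma span_coord S k i : S k -> span S (coord k i).
Proof. by move=> Sk; exact: (lin_gen (stack S z) (exist _ k Sk, i)). Qed.

Lemma span_min S (V : set (T -> R)) : subspace V ->
  (forall k i, S k -> V (coord k i)) -> span S `<=` V.
Proof. by move=> sV VS; apply: lin_min => // -[[k Sk] i]; exact: VS. Qed.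

Lemma span_subspace S : subspace (span S).
Proof. exact: lin_subspace. Qed.

Lemma spanS S S' : (forall k, S k -> S' k) -> span S `<=` span S'.
Proof.
move=> SS'; apply: span_min; first exact: span_subspace.
by move=> k i /SS'; exact: span_coord.
Qed.

Lemma generators_measurable S : generators S z `<=` measurable.
Proof.
move=> _ [k _ [A mA <-]]; apply: measurable_funPT => //.
Qed.

Lemma span_generators_measurable S f : span S f ->
  measurable_fun setT (f : g_sigma_algebraType (generators S z) -> R).
Proof.
move: f; apply: (@span_min S [set f | measurable_fun setT
    (f : g_sigma_algebraType (generators S z) -> R)]).
  split; first exact: measurable_cst.
  by move=> a f g mf mg; apply: measurable_funD => //; exact: measurable_funM.
move=> k i Sk; rewrite /= coordE.
apply: (measurableT_comp (measurable_tnth i)).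
by move=> _ A mA; apply: sub_sigma_algebra; exists k => //; exists A.
Qed.

(** Brings the sigma-algebra of the random vectors within reach of [gaussian_independent], which
    speaks of half-spaces. *)
Lemma generators_halfspaces S :
  <<s generators S z >> `<=` <<s halfspaces (span S) >>.
Proof.
apply: smallest_sub; first exact: smallest_sigma_algebra.
move=> _ [k Sk [A mA <-]].
suff : measurable_fun setT
  (z k : g_sigma_algebraType (halfspaces (span S)) -> d.-tuple R).
  by move=> /(_ measurableT A mA).
apply/measurable_fun_tnthP => i.
have := gaussian_halfspace_measurable (@span_coord S k i Sk).
by rewrite coordE.
Qed.

Variable L : set (T -> R).
Hypothesis gL : gaussian_space P L.

(** The residual is independent of [z_S] and [h] is a function of [z_S], so [h] may be frozen at [w]
    while the residual is averaged. The resulting function involves [S] only through [h]. *)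
Lemma cond_cdf_version S k (h : 'I_d -> T -> R) (xi : 'cV[R]_d) :
  span S `<=` L -> (forall i, L (coord k i)) -> (forall i, span S (h i)) ->
  (forall i f, span S f -> ip P (fun w => coord k i w - h i w) f = 0) ->
  is_cond_prob P (generators S z)
    [set w | forall i, rvec (z k) w i 0 <= xi i 0]
    (fun w => fine (P [set w' | forall i,
       coord k i w' - h i w' <= xi i 0 - h i w])).
Proof.
move=> SL Lk Sh orth.
pose r i w := coord k i w - h i w.
pose U := lin r.
have Lr i : L (r i) by apply: (subspaceB gL.1) => //; exact: SL.
have UL : U `<=` L by apply: lin_min => //; exact: gL.1.
have mU u : U u -> measurable_fun setT u by move=> /UL/gL.2[].
have GM := @generators_measurable S.
have HM := halfspaces_measurable mU.
have indep A B : <<s generators S z >> B -> <<s halfspaces U >> A ->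
    P (B `&` A) = (P B * P A)%E.
  move=> hB hA; apply: (gaussian_independent gL SL UL) => //.
  - exact: span_subspace.
  - exact: lin_subspace.
  - move=> f u Sf Uu; suff [] : [set g | L g /\ ip P f g = 0] u by [].
    apply: lin_min Uu; first exact: (ip_subspace gL (SL _ Sf)).
    by move=> i; split; [exact: Lr|rewrite ipC; exact: orth].
  - exact: generators_halfspaces.
(* [T] carries two independent sigma-algebras: that of [z_S] ([T1]) and that of
   the residual [r] ([T2]).  Hence the image of [P] under [w |-> (w, w)] is a
   product measure on [T1 * T2]. *)
pose T1 := g_sigma_algebraType (generators S z).
pose T2 := g_sigma_algebraType (halfspaces U).
pose m1 := sub_prob P GM; pose m2 := sub_prob P HM.
pose diag (w : T) : T1 * T2 := (to_sub (generators S z) w, to_sub (halfspaces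
  U) w).
have mdiag : measurable_fun setT diag.
  by apply: measurable_fun_pair; exact: measurable_to_sub.
pose diag' : {mfun T >-> (T1 * T2)%type} :=
  HB.pack diag (isMeasurableFun.Build _ _ _ _ _ mdiag).
have prodE X : measurable X -> (m1 \x m2)%E X = P (diag @^-1` X).
  move=> mX; rewrite (product_measure_unique (m' := distribution P diag'))//.
  by move=> A B mA mB; rewrite -indep.
pose E : set (T1 * T2) := [set p | forall i, r i p.2 <= xi i 0 - h i p.1].
have mr i : measurable_fun setT (r i : T2 -> R).
  by apply: gaussian_halfspace_measurable; exact: lin_gen.
have mh i : measurable_fun setT (h i : T1 -> R).
  exact: span_generators_measurable.
have mE : measurable E.
  rewrite (_ : E = \bigcap_(i in [set: 'I_d]) [set p | r i p.2 + h i p.1 <= xi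
    i 0]); last first.
    by apply/seteqP; split=> p /= H i => [_|]; have := H i; rewrite lerBrDr//;
      apply.
  apply: fin_bigcap_measurable => // i _.
  have mf : measurable_fun setT (fun p : T1 * T2 => r i p.2 + h i p.1).
    apply: measurable_funD.
      exact: (measurableT_comp (mr i) measurable_snd).
    exact: (measurableT_comp (mh i) measurable_fst).
  have := mf measurableT `]-oo, xi i 0]%classic (measurable_itv _).
  rewrite setTI; congr measurable; apply/seteqP; split=> p /=;
    by rewrite in_itv.
pose G w := P [set w' | forall i, r i w' <= xi i 0 - h i w].
have GE : G = m2 \o xsection E.
  apply/funext => w; rewrite /G /=; congr (P _).
  by apply/seteqP; split=> w'; rewrite /xsection/= inE.
have mG : measurable_fun setT (G : T1 -> \bar R).
  by rewrite GE; exact: measurable_fun_xsection.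
have G1 w : (0 <= G w <= 1)%E.
  rewrite GE/= measure_ge0 (probability_le1 m2)//; exact: measurable_xsection.
have fG w : G w \is a fin_num.
  by have /andP[g0 g1] := G1 w; rewrite ge0_fin_numE// (le_lt_trans g1)// ltry.
have mfG : measurable_fun setT ((fun w => fine (G w)) : T1 -> R).
  exact: measurableT_comp mG.
have GfE : EFin \o (fun w => fine (G w)) = G.
  by apply/funext => w; rewrite /= fineK.
have mGT : measurable_fun setT (G : T -> \bar R).
  by have := measurableT_comp mG (measurable_to_sub GM).
split => //.
- apply: (@bounded_integrable _ _ _ P _ 1); first exact: measurable_sub mfG.
  move=> w; have /andP[g0 g1] := G1 w.
  by rewrite ger0_norm ?(fine_ge0 g0)// -lee_fin (fineK (fG w)).
- move=> B mB.
  transitivity (\int[m1]_(w in B) G w)%E.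
    rewrite [RHS](ge0_integral_pushforward (measurable_to_sub GM) P mB).
    + by apply: eq_integral => w _; exact: (fineK (fG w)).
    + exact: measurable_funTS.
    + by move=> w _; have /andP[] := G1 w.
  have mBT : measurable ((B : set T1) `*` [set: T2]).
    by apply: measurableX => //; exact: mB.
  (* This set is measured in two ways: pulled back along the diagonal it is the event intersected
     with [B]; by sections it gives the integral of [G] over [B]. *)
  transitivity ((m1 \x m2)%E (E `&` ((B : set T1) `*` setT))); last first.
    rewrite prodE; last exact: measurableI.
    congr (P _); apply/seteqP; split=> w /=.
      by move=> [H [Bw _]]; split=> // i; have := H i; rewrite /r lerD2r.
    by move=> [H Bw]; split=> // i; rewrite /r lerD2r; exact: H.
  rewrite /product_measure1 integral_mkcond; apply: eq_integral => w _.
  rewrite patchE; case: ifPn; rewrite ?inE ?notin_setE => Bw; rewrite /=.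
    rewrite GE/=; congr (P _); apply/seteqP; split=> w';
      rewrite /xsection/= !inE/=.
      by move=> H; split.
    by move=> [].
  rewrite (_ : xsection _ _ = set0) ?measure0//.
  apply/seteqP; split=> w' //; rewrite /xsection/= inE/= => -[_ [Bw' _]].
  exact: Bw.
Qed.

End conditional_cdf.

Section conditional_independence.
Context {disp : measure_display} {T : measurableType disp} {R : realType}.
Context {P : probability T R} {n d : nat}.
Variable z : 'I_n -> {RV P >-> d.-tuple R}.
Variable L : set (T -> R).
Hypothesis gL : gaussian_space P L.
Variables (S S' : pred 'I_n) (k : 'I_n).
Hypothesis S'S : forall i, S' i -> S i.
Hypothesis SL : span z S `<=` L.
Hypothesis kL : forall i, L (coord z k i).

Definition residual_orthogonal : Prop := forall i, exists2 h, span z S' h &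
  forall f, span z S f -> ip P (fun w => coord z k i w - h w) f = 0.

Let lower (xi : 'cV[R]_d) : set T := [set w | forall i, rvec (z k) w i 0 <= xi
  i 0].

Let measurable_lower xi : measurable (lower xi).
Proof.
rewrite (_ : lower xi = \bigcap_(i in [set: 'I_d]) [set w | coord z k i w <= xi
  i 0]).
  apply: fin_bigcap_measurable => // i _.
  have := measurable_coord z k i measurableT (measurable_itv `]-oo, xi i 0]).
  by rewrite setTI; congr measurable; apply/seteqP; split=> w /=;
    rewrite in_itv.
by apply/seteqP; split=> w H i => [_|]; apply: H.
Qed.

(** One [h] serves for [S] and for [S'], so the explicit versions of the two conditional CDFs are
    literally the same function. *)
Lemma cond_cdf_eq_of_residual : residual_orthogonal ->
  forall xi, cond_cdf S z k xi = cond_cdf S' z k xi %[ae P].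
Proof.
move=> /(_ _)/cid2 H xi.
pose h i := s2val (H i).
have hS' i : span z S' (h i) by exact: s2valP.
have ho i : forall f, span z S f -> ip P (fun w => coord z k i w - h i w) f = 0.
  exact: (s2valP' (H i)).
have SS := @spanS _ _ _ _ _ _ z S' S S'S.
have GM := @generators_measurable _ _ _ P n d z.
have v1 := cond_cdf_version gL xi SL kL (fun i => SS _ (hS' i)) ho.
have v2 := cond_cdf_version gL xi (subset_trans SS SL) kL hS'
  (fun i f Sf => ho i f (SS _ Sf)).
have e1 := is_cond_prob_ae (GM S) (cond_probP P (GM S) (measurable_lower xi))
  v1.
have e2 := is_cond_prob_ae (GM S') (cond_probP P (GM S') (measurable_lower xi))
  v2.
by apply: filterS2 e1 e2 => w e1 e2 _; rewrite /cond_cdf -/(lower xi) e1// e2.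
Qed.

Lemma residual_of_cond_cdf_eq :
  (forall xi, cond_cdf S z k xi = cond_cdf S' z k xi %[ae P]) ->
  residual_orthogonal.
Proof.
move=> H i.
have SS := @spanS _ _ _ _ _ _ z S' S S'S.
have S'L : span z S' `<=` L by exact: subset_trans SL.
have proj g : L g -> exists2 h, span z S' h &
    forall f, span z S' f -> ip P (fun w => g w - h w) f = 0.
  by apply: (projection gL) => -[[j Sj] l]; apply: S'L; exact: span_coord.
have [h hS' ho] := proj _ (kL i).
exists h => // g Sg; have Lg := SL Sg; have Lh := S'L _ hS'.
have [g' g'S' g'o] := proj _ Lg; have Lg' := S'L _ g'S'.
(* [v] is a function of [z_S] that is independent of [z_S'] *)
pose v w := g w - g' w.
have Sv : span z S v by apply: (subspaceB (span_subspace z S)) => //; exact: SS.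
have Lv : L v by exact: SL.
(* Here [g = v + g']: the residual is orthogonal to [g'] by the choice of [h], and [h] is orthogonal
   to [v] by the choice of [g']. *)
suff kv : ip P (coord z k i) v = 0.
  have Lr : L (fun w => coord z k i w - h w) by exact: (subspaceB gL.1).
  have -> : g = (fun w => v w + g' w) by apply/funext => w; rewrite /v subrK.
  rewrite ipC (ipD gL)// [ip P g' _]ipC ho// addr0 ipC.
  by rewrite (ipB gL)// kv [ip P h v]ipC g'o// subrr.
have GM := @generators_measurable _ _ _ P n d z.
have mv : measurable_fun setT v by have [] := gL.2 _ Lv.
pose U := lin (fun _ : 'I_1 => v).
have UL : U `<=` L by apply: lin_min => //; exact: gL.1.
have vS Y : measurable Y -> <<s generators S z>> (v @^-1` Y).
  move=> mY; have := span_generators_measurable Sv measurableT mY.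
  by rewrite setTI.
have vind Y C : measurable Y -> <<s generators S' z>> C ->
    P (v @^-1` Y `&` C) = (P (v @^-1` Y) * P C)%E.
  move=> mY hC; apply: (gaussian_independent gL UL S'L) => //.
  - exact: lin_subspace.
  - exact: span_subspace.
  - move=> u f Uu S'f.
    have Lf := S'L _ S'f.
    suff [] : [set u | L u /\ ip P f u = 0] u by rewrite ipC.
    apply: lin_min Uu; first exact: (ip_subspace gL Lf).
    by move=> _; split=> //; rewrite ipC; exact: g'o.
  - have := gaussian_halfspace_measurable (lin_gen (fun _ : 'I_1 => v) ord0).
    by move=> /(_ measurableT Y mY); rewrite setTI.
  - exact: generators_halfspaces.
(* The event that [v] lies in [Y] belongs to the sigma-algebra of [z_S], so the CDF given [z_S] may
   be integrated over it. The CDF given [z_S'], equal by assumption, is independent of [v], and the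
   integral factorizes. *)
have lower_ind xi Y : measurable Y ->
    P (lower xi `&` v @^-1` Y) = (P (lower xi) * P (v @^-1` Y))%E.
  move=> mY.
  have [_ i1 E1] := cond_probP P (GM S) (measurable_lower xi).
  have [m1' i2 E2] := cond_probP P (GM S') (measurable_lower xi).
  have mvY : measurable (v @^-1` Y) by rewrite -[X in measurable X]setTI;
    exact: mv.
  rewrite -(E1 _ (vS _ mY)).
  transitivity (\int[P]_(w in v @^-1` Y) (cond_cdf S' z k xi w)%:E)%E.
    apply: ae_eq_integral => //.
    - by apply: measurable_funTS; exact: (measurable_int _ i1).
    - by apply: measurable_funTS; exact: (measurable_int _ i2).
    - by apply: filterS (H xi) => w e _; congr EFin; exact: e.
  pose f := cond_cdf S' z k xi; rewrite integral_indic_mul.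
  pose I : T -> R := \1_(v @^-1` Y).
  have iI : P.-integrable setT (EFin \o I) by exact: integrable_indic.
  have ifI : P.-integrable setT (EFin \o (fun w => f w * I w)).
    have mf : measurable_fun setT f
      by have /integrableP[/measurable_EFinP] := i2.
    have mI : measurable_fun setT I by exact: measurable_indic.
    apply: (le_integrable measurableT _ _ i2).
      by apply/measurable_EFinP; exact: measurable_funM.
    move=> w _; rewrite lee_fin normrM ler_piMr// /I indicE.
    by case: (_ \in _); rewrite /= ?normr1 ?normr0.
  have ind A B : measurable A -> measurable B ->
      P (f @^-1` A `&` I @^-1` B) = (P (f @^-1` A) * P (I @^-1` B))%E.
    move=> mA mB; rewrite setIC muleC; apply: (vind ((\1_Y : R -> R) @^-1` B)).
      rewrite -[X in measurable X]setTI.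
      exact: (measurable_indic mY measurableT).
    by have := m1' measurableT A mA; rewrite setTI.
  have e := independent_expectation i2 iI ifI ind.
  have GT : <<s generators S' z>> setT.
    exact: (@measurableT _ (g_sigma_algebraType (generators S' z))).
  rewrite -[LHS]fineK; last exact: integrable_fin_num.
  rewrite [X in X%:E]e EFinM; congr (_ * _)%E.
    by rewrite fineK; [rewrite E2// setIT|exact: integrable_fin_num].
  by rewrite /Rintegral integral_indic// setIT fineK// fin_num_measure.
(* The lower orthants form a pi-system, with coordinatewise minima as corners, and make each
   coordinate measurable. *)
have coord_ind X Y : measurable X -> measurable Y ->
    P (coord z k i @^-1` X `&` v @^-1` Y) = (P (coord z k i @^-1` X) * P (v
      @^-1` Y))%E.
  move=> mX mY; apply: (independent_dynkin (G := range lower)).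
  - by rewrite -[X in measurable X]setTI; exact: mv.
  - move=> _ _ [xi _ <-] [eta _ <-].
    exists (\col_j Num.min (xi j 0) (eta j 0)) => //.
    apply/seteqP; split=> w /=.
      by move=> wm; split=> j; have := wm j; rewrite mxE le_min => /andP[].
    by move=> [H1 H2] j; rewrite mxE le_min H1 H2.
  - by move=> _ [xi _ <-].
  - by move=> _ [xi _ <-]; exact: lower_ind.
  - have mk : measurable_fun setT (coord z k i : g_sigma_algebraType (range
      lower) -> R).
      apply: measurable_fun_halfline => t.
      (* An orthant bounds all coordinates at once; a half-space in coordinate [i] is recovered by
         letting the other bounds run through the naturals. *)
      rewrite (_ : [set w | _] = \bigcup_m lower (\col_j if j == i then t else
        m%:R)).
        apply: bigcup_measurable => m _; apply: sub_sigma_algebra.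
        by eexists.
      apply/seteqP; split=> w /=.
        move=> wt; pose M := \sum_j `|coord z k j w|.
        exists (Num.bound M) => // j; rewrite mxE; case: eqP => [->//|_].
        rewrite (le_trans (ler_norm _))// (@le_trans _ _ M)//.
          by rewrite /M (bigD1 j)//= lerDl sumr_ge0.
        by apply/ltW/archi_boundP; exact: sumr_ge0.
      by move=> [m _ /(_ i)]; rewrite mxE eqxx.
    by have := mk measurableT X mX; rewrite setTI.
have [mk gk k0] := gL.2 _ (kL i).
have [_ gv v0] := gL.2 _ Lv.
rewrite /ip (independent_expectation _ _ _ coord_ind) ?k0 ?mul0r//.
- exact: gaussian_integrable.
- exact: gaussian_integrable.
- exact: (gaussian_spaceM gL).
Qed.

End conditional_independence.

(** * Subtraction of the trend *)

Section gram.
Context {disp : measure_display} {T : measurableType disp} {R : realType}.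
Variable P : probability T R.
Variable L : set (T -> R).
Hypothesis gL : gaussian_space P L.

Lemma gaussian_expectation f : L f -> ('E_P[f] = 0)%E.
Proof.
move=> /gL.2[mf gf f0]; rewrite unlock; apply: Rintegral0E => //.
exact: gaussian_integrable.
Qed.

Lemma gaussian_covariance f g : L f -> L g -> covariance P f g = (ip P f g)%:E.
Proof.
move=> Lf Lg; rewrite covariance.unlock (gaussian_expectation Lf)
  (gaussian_expectation Lg) unlock /=.
rewrite /ip /Rintegral fineK; last first.
  by apply: integrable_fin_num => //; exact: gaussian_spaceM Lf Lg.
by apply: eq_integral => w _; rewrite !fctE /= !subr0.
Qed.

Lemma ip_sum (J : finType) (u : J -> T -> R) (a : J -> R) g :
  (forall j, L (u j)) -> L g ->
  ip P (fun w => \sum_j a j * u j w) g = \sum_j a j * ip P (u j) g.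
Proof.
move=> Lu Lg; elim: (index_enum J) => [|j s IH].
  by rewrite big_nil; under eq_fun do rewrite big_nil; rewrite ip0.
rewrite big_cons -IH -(ip_linear gL)//.
  by congr ip; apply/funext => w; rewrite big_cons.
elim: s {IH} => [|i s IH]; first by under eq_fun do rewrite big_nil;
  exact: gL.1.1.
by under eq_fun do rewrite big_cons; exact: gL.1.2.
Qed.

(** Rows of the inverse covariance are the coefficients of dual vectors. Conversely, a kernel vector
    gives a combination [f] of the [u j] of norm zero, hence orthogonal to all of [L]; pairing it
    with a dual vector extracts a coefficient, which must vanish. *)
Lemma cov_mx_dual (J : finType) (u : J -> T -> R) : (forall j, L (u j)) ->
  cov_mx P u \in unitmx <->
  forall j, exists2 g, L g & forall i, ip P g (u i) = (i == j)%:R.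
Proof.
move=> Lu.
have GE i j : cov_mx P u i j = ip P (u (enum_val i)) (u (enum_val j)).
  by rewrite mxE gaussian_covariance.
have sumE (F : J -> R) : \sum_j F j = \sum_(i < #|J|) F (enum_val i).
  by rewrite -big_enum_val.
have Lsum (a : J -> R) : L (fun w => \sum_j a j * u j w).
  by apply: (lin_min gL.1 Lu); exists a.
split=> [Gu j|H].
  exists (fun w => \sum_i invmx (cov_mx P u) (enum_rank j) (enum_rank i) * u i
    w).
    exact: Lsum.
  move=> i; rewrite ip_sum// sumE.
  transitivity ((invmx (cov_mx P u) *m cov_mx P u) (enum_rank j) (enum_rank i)).
    by rewrite mxE; apply: eq_bigr => l _; rewrite GE enum_valK enum_rankK.
  by rewrite mulVmx// mxE (inj_eq enum_rank_inj) eq_sym.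
rewrite unitmxE unitfE; apply/negP => /det0P[v v0 vG].
pose a j := v 0 (enum_rank j); pose f w := \sum_j a j * u j w.
have Lf : L f by exact: Lsum.
have fu j : ip P f (u j) = 0.
  rewrite ip_sum// sumE; transitivity ((v *m cov_mx P u) 0 (enum_rank j)).
    by rewrite mxE; apply: eq_bigr => i _; rewrite GE /a enum_valK enum_rankK.
  by rewrite vG mxE.
have ff : ip P f f = 0.
  rewrite {1}/f ip_sum// big1// => j _.
  by rewrite ipC fu mulr0.
case/negP: v0; apply/eqP/rowP => j; rewrite !mxE.
have [g Lg gu] := H (enum_val j).
have := ip_degenerate gL Lf Lg ff.
rewrite ipC ip_sum// (bigD1 (enum_val j))//= ipC gu eqxx mulr1 big1 ?addr0.
  by rewrite /a enum_valK.
by move=> i /negbTE ij; rewrite ipC gu ij mulr0.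
Qed.

End gram.

Section detrend.
Context {disp : measure_display} {T : measurableType disp} {R : realType}.
Context {P : probability T R} {n d : nat}.
Variables (x : 'I_n -> {RV P >-> d.-tuple R}) (c : 'I_n).
Variable Gamma : 'I_n -> 'M[R]_d.

Let detrend_fun k w : d.-tuple R := [tuple coord x k i w -
  \sum_l Gamma k i l * coord x c l w | i < d].

Let measurable_detrend k : measurable_fun setT (detrend_fun k).
Proof.
apply/measurable_fun_tnthP => i; rewrite (_ : _ \o _ = fun w => coord x k i w -
  \sum_l Gamma k i l * coord x c l w); last first.
  by apply/funext => w /=; rewrite tnth_mktuple.
apply: measurable_funB; first exact: measurable_coord.
apply: measurable_sum => l; apply: measurable_funM => //.
exact: measurable_coord.
Qed.

Definition detrend k : {RV P >-> d.-tuple R} :=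
  HB.pack (detrend_fun k) (isMeasurableFun.Build _ _ _ _ _ (measurable_detrend
    k)).

Lemma coord_detrendE k i : coord detrend k i =
  fun w => coord x k i w - \sum_l Gamma k i l * coord x c l w.
Proof. by rewrite coordE; apply/funext => w; rewrite tnth_mktuple. Qed.

Lemma detrend_trend_span k i :
  span x (pred1 c) (fun w => \sum_l Gamma k i l * coord x c l w).
Proof.
have : lin (coord x c) (fun w => \sum_l Gamma k i l * coord x c l w).
  by exists (fun l => Gamma k i l).
apply: lin_min; first exact: span_subspace.
by move=> l; apply: span_coord; rewrite /= eqxx.
Qed.

Variables (Sx Sy : pred 'I_n).
Hypothesis Sxy : forall i, Sx i = Sy i || (i == c).

Let cSx : span x (pred1 c) `<=` span x Sx.
Proof. by apply: spanS => i /= ic; rewrite Sxy ic orbT. Qed.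

Lemma span_detrend : span detrend Sy `<=` span x Sx.
Proof.
apply: span_min => [|k i Syk]; first exact: span_subspace.
rewrite coord_detrendE; apply: (subspaceB (span_subspace x Sx)).
  by apply: span_coord; rewrite Sxy Syk.
by apply: cSx; exact: detrend_trend_span.
Qed.

(** For [k != c] the coordinate of [x_k] is that of [y_k] plus its trend; [x_c] goes entirely into
    the second summand. *)
Lemma span_detrend_split f : span x Sx f -> exists f1 f2,
  [/\ span detrend Sy f1, span x (pred1 c) f2 & f = fun w => f1 w + f2 w].
Proof.
have s1 := span_subspace detrend Sy; have s2 := span_subspace x (pred1 c).
move: f; apply: (@span_min _ _ _ _ _ _ x Sx [set f | exists f1 f2,
  [/\ span detrend Sy f1, span x (pred1 c) f2 & f = fun w => f1 w + f2 w]]).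
  split.
    exists (cst 0), (cst 0); split; [exact: s1.1|exact: s2.1|].
    by apply/funext => w; rewrite addr0.
  move=> a _ _ [f1 [f2 [Sf1 Sf2 ->]]] [g1 [g2 [Sg1 Sg2 ->]]].
  exists (fun w => a * f1 w + g1 w), (fun w => a * f2 w + g2 w).
  split; [exact: s1.2|exact: s2.2|].
  by apply/funext => w; rewrite mulrDr addrACA.
move=> k i; rewrite Sxy => Sk.
have [->|kc] := eqVneq k c.
  exists (cst 0), (coord x c i); split; first exact: s1.1.
    by apply: span_coord; rewrite /= eqxx.
  by apply/funext => w; rewrite add0r.
exists (coord detrend k i), (fun w => \sum_l Gamma k i l * coord x c l w);
  split.
- apply: span_coord; by move: Sk; rewrite (negbTE kc) orbF.
- exact: detrend_trend_span.
- by apply/funext => w; rewrite coord_detrendE subrK.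
Qed.

End detrend.

Section residual.
Context {disp : measure_display} {T : measurableType disp} {R : realType}.
Context {P : probability T R} {n d : nat}.
Variables (x : 'I_n -> {RV P >-> d.-tuple R}) (c : 'I_n).
Variable L : set (T -> R).
Hypothesis gL : gaussian_space P L.

(** Needed because the given [y] agrees with [x - Gamma x_c] only almost surely, and only at indices
    other than [c]. *)
Lemma residual_ae (z z' : 'I_n -> {RV P >-> d.-tuple R}) (S S' : pred 'I_n) k :
  (forall l, S' l -> S l) ->
  (forall l i, S l || (l == k) -> coord z l i = coord z' l i %[ae P]) ->
  residual_orthogonal z S S' k -> residual_orthogonal z' S S' k.
Proof.
move=> S'S zz' H i; have [h Sh ho] := H i.
have mspan (u : 'I_n -> {RV P >-> d.-tuple R}) (V : pred 'I_n) f :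
    span u V f -> measurable_fun setT f.
  by move=> /span_generators_measurable; apply: measurable_sub;
    exact: generators_measurable.
have tr (u u' : 'I_n -> {RV P >-> d.-tuple R}) (V : pred 'I_n) :
    (forall l j, V l -> coord u l j = coord u' l j %[ae P]) ->
    forall f, span u V f -> exists2 f', span u' V f' & f = f' %[ae P].
  move=> uu'; apply: (@span_min _ _ _ _ _ _ u V [set f | exists2 f', span u' V
    f' & f = f' %[ae P]]).
    split.
      by exists (cst 0); [exact: (span_subspace u' V).1|exact: aeW].
    move=> a f g [f' Sf' ff'] [g' Sg' gg'].
    exists (fun w => a * f' w + g' w); first exact: (span_subspace u' V).2.
    by apply: filterS2 ff' gg' => w e1 e2 _; rewrite e1// e2.
  move=> l j Vl; exists (coord u' l j); first exact: span_coord.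
  exact: uu'.
have [h' Sh' hh'] : exists2 h', span z' S' h' & h = h' %[ae P].
  by apply: tr Sh => l j /S'S Sl; apply: zz'; rewrite Sl.
exists h' => // f' Sf'.
have [f Sf ff'] : exists2 f, span z S f & f' = f %[ae P].
  apply: tr Sf' => l j Sl; have := zz' l j; rewrite Sl => /(_ isT).
  by apply: filterS => w e /e.
rewrite -(ho f Sf); congr fine; apply: ae_eq_integral => //.
- apply/measurable_EFinP; apply: measurable_funM; last exact: mspan Sf'.
  by apply: measurable_funB; [exact: measurable_coord|exact: mspan Sh'].
- apply/measurable_EFinP; apply: measurable_funM; last exact: mspan Sf.
  by apply: measurable_funB; [exact: measurable_coord|exact: mspan Sh].
have := zz' k i; rewrite eqxx orbT => /(_ isT) => kk'.
move: hh' ff' kk'; apply: filterS3 => w e1 e2 e3 _.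
by rewrite e1// e2// e3.
Qed.

Variables (Gamma : 'I_n -> 'M[R]_d) (Sx Sx' Sy Sy' : pred 'I_n) (k : 'I_n).
Local Notation yy := (detrend x c Gamma).
Hypothesis xL : forall l i, L (coord x l i).
Hypothesis orth : forall l i j, l != c -> ip P (coord yy l i) (coord x c j) = 0.
Hypothesis Sxy : forall i, Sx i = Sy i || (i == c).
Hypothesis Sxy' : forall i, Sx' i = Sy' i || (i == c).
Hypothesis Syc : forall i, Sy i -> i != c.
Hypothesis Syc' : forall i, Sy' i -> i != c.
Hypothesis kc : k != c.

Let xSL S : span x S `<=` L.
Proof. by apply: span_min => // ; exact: gL.1. Qed.

Let yL l i : L (coord yy l i).
Proof.
rewrite coord_detrendE; apply: (subspaceB gL.1) => //.
by apply: (@xSL (pred1 c)); exact: detrend_trend_span.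
Qed.

Let ySL S : span yy S `<=` L.
Proof. by apply: span_min => // ; exact: gL.1. Qed.

Let orth_span (S : pred 'I_n) f g : (forall i, S i -> i != c) -> span yy S f ->
  span x (pred1 c) g -> ip P f g = 0.
Proof.
move=> Sc Sf Sg; have Lf := ySL Sf; have Lg := xSL Sg.
suff [] : [set g | L g /\ ip P f g = 0] g by [].
apply: span_min Sg; first exact: ip_subspace.
move=> l j /eqP ->; split=> //; rewrite ipC.
have Lc := xL c j.
suff [] : [set f | L f /\ ip P (coord x c j) f = 0] f by [].
apply: span_min Sf; first exact: ip_subspace.
by move=> l' i Sl'; split=> //; rewrite ipC orth// Sc.
Qed.

Let orth_k i g : span x (pred1 c) g -> ip P (coord yy k i) g = 0.
Proof.
move=> Sg; apply: (orth_span (S := pred1 k)) Sg => [l /eqP -> //|].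
by apply: span_coord; rewrite /= eqxx.
Qed.

Let trend i w := \sum_l Gamma k i l * coord x c l w.

Let trendS i : span x (pred1 c) (trend i).
Proof. exact: detrend_trend_span. Qed.

(** From [x] to [y], the [x_c] part of [h] is dropped: the residual changes by an element of the
    span of [x_c], which is orthogonal to [y]. From [y] to [x], adding the trend to [h] leaves the
    residual unchanged, and it is orthogonal to [x_c] as well. *)
Lemma residual_detrend :
  residual_orthogonal x Sx Sx' k <-> residual_orthogonal yy Sy Sy' k.
Proof.
split=> H i; have [h Sh ho] := H i.
  have [h1 [h2 [Sh1 Sh2 hE]]] := span_detrend_split Gamma Sxy' Sh.
  exists h1 => // f Sf; have Lf := ySL Sf; have Lh1 := ySL Sh1;
    have Lh2 := xSL Sh2.
  have Lt := xSL (trendS i); have Lh := xSL Sh.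
  have Lr : L (fun w => coord x k i w - h w) by exact: (subspaceB gL.1).
  have Lt' : L (fun w => h2 w - trend i w) by exact: (subspaceB gL.1).
  have -> : (fun w => coord yy k i w - h1 w) =
      (fun w => (coord x k i w - h w) + (h2 w - trend i w)).
    by apply/funext => w; rewrite coord_detrendE hE /trend; ring.
  rewrite (ipD gL)// ho ?add0r; last exact: (span_detrend Sxy Sf).
  by rewrite (ipB gL)// [ip P h2 f]ipC [ip P (trend i) f]ipC !(orth_span Syc
    Sf)// subrr.
have Lt := xSL (trendS i); have Lh := ySL Sh; have Lk := yL k i.
exists (fun w => h w + trend i w).
  apply: (subspaceD (span_subspace x Sx')); first exact: (span_detrend Sxy') Sh.
  by apply: (@spanS _ _ _ _ _ _ x (pred1 c) Sx') => // l /= lc;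
    rewrite Sxy' lc orbT.
move=> f Sf; have [f1 [f2 [Sf1 Sf2 ->]]] := span_detrend_split Gamma Sxy Sf.
have Lf1 := ySL Sf1; have Lf2 := xSL Sf2.
have -> : (fun w => coord x k i w - (h w + trend i w)) = (fun w => coord yy k i
  w - h w).
  by apply/funext => w; rewrite coord_detrendE /trend; ring.
have Lr : L (fun w => coord yy k i w - h w) by exact: (subspaceB gL.1).
rewrite ipC (ipD gL)// ![ip P _ (fun w => _ - _)]ipC ho// add0r.
by rewrite (ipB gL)// orth_k// (orth_span Syc' Sh)// subrr.
Qed.

End residual.

(** Unlike [gaussian_covariance], this does not place [f] and [g] in a common Gaussian space; it is
    meant for [y_k] and [x_c], whose means vanish in separate spans. *)
Lemma covariance_ip disp (T : measurableType disp) (R : realType)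
    (P : probability T R) (f g : T -> R) :
  ('E_P[f] = 0)%E -> ('E_P[g] = 0)%E -> fine (covariance P f g) = ip P f g.
Proof.
move=> f0 g0; rewrite covariance.unlock f0 g0 unlock; congr fine.
by apply: eq_integral => w _; rewrite !fctE /= !subr0.
Qed.

(** * Zero-mean nonsingular Gaussian families and the equivalence *)

Section zmng.
Context {disp : measure_display} {T : measurableType disp} {R : realType}.
Context {P : probability T R} {n d : nat}.

Lemma ZMNG_gaussian_space (S : pred 'I_n) (z : 'I_n -> {RV P >-> d.-tuple R}) :
  ZMNG S z -> gaussian_space P (span z S).
Proof.
by move=> [gz z0 _]; apply: gaussian_space_lin => // p; exact: measurable_coord.
Qed.

Variables (x : 'I_n -> {RV P >-> d.-tuple R}) (c : 'I_n).
Hypothesis Zx : ZMNG predT x.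
Local Notation L := (span x predT).

Let gL : gaussian_space P L. Proof. exact: ZMNG_gaussian_space. Qed.

Let xL k i : L (coord x k i). Proof. exact: span_coord. Qed.

Lemma jointly_gaussian_span (J : finType) (u : J -> T -> R) :
  (forall j, L (u j)) -> jointly_gaussian P u.
Proof.
move=> Lu a; suff /gL.2[] : L (fun w => \sum_j a j * u j w) by [].
by apply: (lin_min gL.1 Lu); exists a.
Qed.

Lemma ZMNG_dual (S : pred 'I_n) (z : 'I_n -> {RV P >-> d.-tuple R}) :
  (forall k i, S k -> L (coord z k i)) ->
  (forall k i, S k -> exists2 g, L g & forall l j, S l ->
    ip P g (coord z l j) = ((l == k) && (j == i))%:R) ->
  ZMNG S z.
Proof.
move=> zL dual; have Lz p : L (stack S z p) by apply: zL; exact: (valP p.1).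
split.
- exact: jointly_gaussian_span.
- by move=> p; exact: (gaussian_expectation gL).
- apply/(cov_mx_dual gL Lz) => -[[k Sk] i].
  have [g Lg gz] := dual k i Sk; exists g => // -[[l Sl] j].
  by rewrite [LHS]gz// xpair_eqE.
Qed.

Lemma dual_coord k i : exists2 g, L g & forall l j,
  ip P g (coord x l j) = ((l == k) && (j == i))%:R.
Proof.
have [_ _ /(cov_mx_dual gL)] := Zx.
move=> /(_ (fun p => xL _ _) (exist _ k isT, i))[g Lg gx].
exists g => // l j; have := gx (exist _ l isT, j).
by rewrite xpair_eqE.
Qed.

(** Row [i] of [Gamma k] holds the coefficients of the projection of coordinate [i] of [x_k] on the
    coordinates of [x_c]. *)
Lemma exists_trend : exists Gamma : 'I_n -> 'M[R]_d, forall k i j,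
  ip P (coord (detrend x c Gamma) k i) (coord x c j) = 0.
Proof.
have H k i : exists g : 'I_d -> R, forall j,
    ip P (fun w => coord x k i w - \sum_l g l * coord x c l w) (coord x c j) =
      0.
  have [h [g ->] ho] := projection gL (u := coord x c) (xL c) (xL k i).
  by exists g => j; apply: ho; exact: lin_gen.
have [g Hg] := choice (fun p : 'I_n * 'I_d => H p.1 p.2).
exists (fun k => \matrix_(i, l) g (k, i) l) => k i j.
rewrite -(Hg (k, i) j) coord_detrendE; congr ip; apply/funext => w /=.
by congr (_ - _); apply: eq_bigr => l _; rewrite mxE.
Qed.

Lemma detrend_span Gamma k i : L (coord (detrend x c Gamma) k i).
Proof.
rewrite coord_detrendE; apply: (subspaceB gL.1) => //.
by apply: (spanS (S := pred1 c)) => //; exact: detrend_trend_span.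
Qed.

(** A dual vector of [x] at an index other than [c] is orthogonal to [x_c], so it does not see the
    subtracted trend and remains dual, whatever [Gamma] is. *)
Lemma ZMNG_detrend Gamma : ZMNG (predC1 c) (detrend x c Gamma).
Proof.
apply: ZMNG_dual => [k i _|k i /= kc]; first exact: detrend_span.
have [g Lg gx] := dual_coord k i; exists g => // l j lc.
rewrite coord_detrendE ipC (ipB gL)//; last first.
  by apply: (spanS (S := pred1 c)) => //; exact: detrend_trend_span.
rewrite (ip_sum gL)//.
rewrite ipC gx big1 ?subr0// => m _.
by rewrite ipC gx eq_sym (negbTE kc) mulr0.
Qed.

End zmng.

Theorem proposition4p1 (R : realType) (disp : measure_display)
    (T : measurableType disp) (P : probability T R) (N d : nat)
    (c : 'I_N.+1) (x : 'I_N.+1 -> {RV P >-> d.-tuple R}) :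
  c = ord0 \/ c = ord_max ->
  ZMNG predT x ->
  CM c x <->
  exists (y : 'I_N.+1 -> {RV P >-> d.-tuple R}) (Gamma : 'I_N.+1 -> 'M[R]_d),
    [/\ ZMNG (predC1 c) y /\ is_markov (predC1 c) y,
        ZMNG (pred1 c) x,
        jointly_gaussian P (stack predT (fun k => if k == c then x c else y k)),
        forall k, k != c -> uncorrelated (y k) (x c) &
        forall k, k != c ->
          {ae P, forall w, rvec (x k) w = rvec (y k) w + Gamma k *m rvec (x c)
            w}].
Proof.
move=> c0N Zx; have gL := ZMNG_gaussian_space Zx.
have xL k i : span x predT (coord x k i) by exact: span_coord.
have xSL (S : pred 'I_N.+1) : span x S `<=` span x predT by exact: spanS.
pose Sx (j : 'I_N.+1) := [pred i : 'I_N.+1 | (i <= j)%N || (i == c)].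
pose Sy (j : 'I_N.+1) := [pred i : 'I_N.+1 | predC1 c i && (i <= j)%N].
have Sxy j i : Sx j i = Sy j i || (i == c).
  by rewrite /=; case: (i == c); rewrite /= ?orbT ?orbF.
have Sxy' (j i : 'I_N.+1) : pred2 j c i = pred1 j i || (i == c) by [].
have Syc j i : Sy j i -> i != c by move=> /andP[].
have trend_eq (Gamma : 'I_N.+1 -> 'M[R]_d) (y : 'I_N.+1 -> {RV P >-> d.-tuple
  R}) k w :
    (rvec (x k) w = rvec (y k) w + Gamma k *m rvec (x c) w) <->
    (forall i, coord y k i w = coord (detrend x c Gamma) k i w).
  have mulE i : (Gamma k *m rvec (x c) w) i 0 = \sum_l Gamma k i l * coord x c
    l w.
    by rewrite mxE.
  split=> [H i|H].
    rewrite coord_detrendE -mulE; apply/eqP; rewrite eq_sym subr_eq; apply/eqP.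
    by rewrite [LHS](congr1 (fun A : 'cV_d => A i 0) H) mxE.
  apply/matrixP => i i0; rewrite ord1 [RHS]mxE mulE -[LHS]/(coord x k i w).
  by rewrite -[rvec (y k) w i 0]/(coord y k i w) H coord_detrendE subrK.
split=> [CMx|[y [Gamma [[Zy My] Zc _ yc xy]]]].
- have [Gamma orth] := exists_trend c Zx.
  exists (detrend x c Gamma), Gamma; split.
  + split; first exact: ZMNG_detrend.
    move=> j k /= jc kc jk xi.
    (* The Markov property of [y] is pulled back to residuals of [y], then to residuals of [x],
       where the assumption on [x] applies. *)
    apply: (cond_cdf_eq_of_residual gL).
    * by move=> i /eqP ->; rewrite /= jc leqnn.
    * apply: span_min; first exact: gL.1.
      by move=> *; exact: detrend_span.
    * by move=> i; exact: detrend_span.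
    apply/(residual_detrend gL xL (fun l i j _ => orth l i j)
      (Sxy j) (Sxy' j)) => //; first exact: Syc.
      by move=> i /eqP ->.
    apply: (residual_of_cond_cdf_eq gL) => //.
    * by move=> i /predU1P[->|/eqP ->]; rewrite /= ?leqnn ?eqxx ?orbT.
    * exact: CMx.
  + apply: (ZMNG_dual Zx) => [k i _|k i kc]; first exact: xL.
    have [g Lg gx] := dual_coord Zx k i.
    by exists g.
  + apply: (jointly_gaussian_span Zx) => -[[k kT] i]; rewrite /stack/=.
    by case: ifP => _; [exact: xL|exact: detrend_span].
  + move=> k kc i j; rewrite (gaussian_covariance gL).
    * by rewrite orth.
    * exact: detrend_span.
    * exact: xL.
  + by move=> k kc; apply: aeW => w; apply/trend_eq.
have yyE k i : k != c -> coord y k i = coord (detrend x c Gamma) k i %[ae P].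
  move=> kc; apply: filterS (xy k kc) => w /trend_eq H _; exact: H.
have gLy := ZMNG_gaussian_space Zy.
have orth k i j : k != c -> ip P (coord (detrend x c Gamma) k i) (coord x c j)
  = 0.
  move=> kc; have := yc k kc i j => /(congr1 fine) /= <-.
  rewrite covariance_ip; last 2 first.
  - exact: (gaussian_expectation gLy (@span_coord _ _ _ _ _ _ y (predC1 c) k i
      kc)).
  - exact: (gaussian_expectation gL (xL c j)).
  congr fine; apply: ae_eq_integral => //.
  - by apply/measurable_EFinP; apply: measurable_funM; exact: measurable_coord.
  - by apply/measurable_EFinP; apply: measurable_funM; exact: measurable_coord.
  - by apply: filterS (yyE k i kc) => w e _; rewrite -e.
move=> j k jk xi.
(* Here the position of [c] matters: [j = c = N] is excluded by [j < k], and for [j = c = 0] both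
   conditioning sets are [{0}]. *)
have [jc|jc] := eqVneq j c.
  rewrite (_ : cond_cdf [pred i : 'I_N.+1 | _ || _] x k xi =
      cond_cdf (pred2 j c) x k xi); first exact: aeW.
  congr cond_cdf; apply/funext => i /=.
  case: c0N => c0; last by move: jk; rewrite jc c0 ltnNge -ltnS ltn_ord.
  by rewrite jc c0 -val_eqE /= leqn0.
apply: (cond_cdf_eq_of_residual gL) => //.
- by move=> i /predU1P[->|/eqP ->]; rewrite /= ?leqnn ?eqxx ?orbT.
(* If [k = c], the variable is among those conditioned on, and its residual is zero. *)
have [kc|kc] := eqVneq k c.
  move=> i; exists (coord x k i); first by apply: span_coord;
    rewrite /= kc eqxx orbT.
  move=> f _; rewrite (_ : (fun w => _) = cst 0) ?ip0//.
  by apply/funext => w; rewrite subrr.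
apply/(residual_detrend gL xL orth (Sxy j) (Sxy' j) (Syc j)) => //.
  by move=> i /eqP ->.
(* The goal concerns [x - Gamma x_c], the Markov hypothesis the almost surely equal [y]. *)
apply: (residual_ae (z := y)).
- by move=> i /eqP ->; rewrite /= jc leqnn.
- by move=> l i /orP[/Syc|/eqP ->]; exact: yyE.
apply: (residual_of_cond_cdf_eq gLy).
- by move=> i /eqP ->; rewrite /= jc leqnn.
- by apply: spanS => i /Syc.
- by move=> i; exact: span_coord.
- by move=> ?; exact: My.
Qed.
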